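(* Let $f$ be a function on $(0,\infty)$ and let $n\ge 2$ be an integer. Suppose that: (1) there is an interval $\mathbb{I}\subseteq\mathbb{R}$ such that for every $p\in\mathbb{I}$ the integral $F_p(x)=\int_0^\infty t^p f(t)e^{-xt}\,dt$ converges for all $x\in(0,\infty)$; (2) there exist constants $M>0$ and $c\ge 0$ such that $0<t^p f(t)\le M e^{ct}$ for all $t>0$ and all $p\in\mathbb{I}$; (3) the $n$-tuples $\boldsymbol{p}=(p_1,\dots,p_n)$ and $\boldsymbol{q}=(q_1,\dots,q_n)$ in $\mathbb{I}^n$ satisfy $\boldsymbol{p}\prec\boldsymbol{q}$. For real $\theta<1+\min\{p_n,q_n\}$ put $$\lambda_n^{[\theta]}=\prod_{j=1}^n\frac{\Gamma(p_j-\theta+1)}{\Gamma(q_j-\theta+1)},\qquad \mathcal{D}(x)=\prod_{j=1}^nF_{p_j}(x)-\lambda_n^{[\theta]}\prod_{j=1}^nF_{q_j}(x).$$ If there is a real $\theta<1+\min\{p_n,q_n\}$ such that $t\mapsto t^\theta f(t)$ is log-concave on $(0,\infty)$, then (for this $\theta$) the function $x\mapsto\mathcal{D}(x)$ is completely monotonic on $(0,\infty)$. If there is a real $\theta<1+\min\{p_n,q_n\}$ such that $t\mapsto t^\theta f(t)$ is log-convex on $(0,\infty)$, then (for this $\theta$) the function $x\mapsto-\mathcal{D}(x)$ is completely monotonic on $(0,\infty)$.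
   Context: A function $h$ is completely monotonic on an interval $I$ if it has derivatives of all orders on $I$ and $(-1)^m h^{(m)}(x)\ge 0$ for all integers $m\ge 0$ and all $x\in I$. For $x=(x_1,\dots,x_n)$ and $y=(y_1,\dots,y_n)$ in $\mathbb{R}^n$, $y\prec x$ means: $x\ne y$, $x_1\ge x_2\ge\cdots\ge x_n$, $y_1\ge y_2\ge\cdots\ge y_n$, $\sum_{j=1}^{m}x_j\ge\sum_{j=1}^{m}y_j$ for $m=1,\dots,n-1$, and $\sum_{j=1}^n x_j=\sum_{j=1}^n y_j$. *)

(* Defs.v *)
From mathcomp Require Import all_boot all_order all_algebra.
From mathcomp Require Import all_classical all_reals all_analysis.

Set Implicit Arguments.
Unset Strict Implicit.
Unset Printing Implicit Defensive.

Import Order.TTheory GRing.Theory Num.Theory.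
Import numFieldNormedType.Exports.

Local Open Scope classical_set_scope.
Local Open Scope ring_scope.

(* [derivable] and [_^`(m)] are two-sided, so [I] is meant to be an open
   interval. *)
Definition completely_monotonic (R : realType) (I : set R) (h : R -> R) : Prop :=
  forall (m : nat) (x : R), I x ->
    derivable (h^`(m))%classic x 1 /\ 0 <= (-1) ^+ m * (h^`(m))%classic x.

(* [majorized y x] is y < x in the majorization order, with both tuples
   nonincreasing and with equality excluded. *)
Definition majorized (R : realType) (n : nat) (y x : n.-tuple R) : Prop :=
  [/\ x != y,
      sorted >=%R x,
      sorted >=%R y,
      forall m : nat, (1 <= m <= n.-1)%N ->
        \sum_(0 <= j < m) y`_j <= \sum_(0 <= j < m) x`_j
    & \sum_(0 <= j < n) x`_j = \sum_(0 <= j < n) y`_j].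

(* [ln] is 0 outside ]0, +oo[, hence the explicit positivity. *)
Definition log_convex (R : realType) (A : set R) (g : R -> R) : Prop :=
  (forall t, A t -> 0 < g t) /\ convex_function A (fun t => ln (g t)).

Definition log_concave (R : realType) (A : set R) (g : R -> R) : Prop :=
  (forall t, A t -> 0 < g t) /\ convex_function A (fun t => - ln (g t)).

(* Meaningful for 0 < a. *)
Definition Gamma (R : realType) (a : R) : R :=
  \int[lebesgue_measure]_(t in `]0, +oo[) (t `^ (a - 1) * expR (- t)).

Definition laplace_integrand (R : realType) (f : R -> R) (p x t : R) : R :=
  t `^ p * f t * expR (- (x * t)).

Definition laplaceF (R : realType) (f : R -> R) (p x : R) : R :=
  \int[lebesgue_measure]_(t in `]0, +oo[) laplace_integrand f p x t.

Definition lambda_ratio (R : realType) (n : nat) (p q : n.-tuple R) (theta : R) : R :=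
  \prod_(j < n) (Gamma (tnth p j - theta + 1) / Gamma (tnth q j - theta + 1)).

Definition laplace_diff (R : realType) (n : nat) (f : R -> R) (p q : n.-tuple R)
    (theta x : R) : R :=
  \prod_(j < n) laplaceF f (tnth p j) x
  - lambda_ratio p q theta * \prod_(j < n) laplaceF f (tnth q j) x.

(* Main.v *)
Require Import Defs.
From HB Require Import structures.
From mathcomp Require Import all_boot all_order all_algebra.
From mathcomp Require Import all_classical all_reals all_analysis.
From mathcomp Require Import ring lra measurable_realfun.

Set Implicit Arguments.
Unset Strict Implicit.
Unset Printing Implicit Defensive.

Import Order.TTheory GRing.Theory Num.Theory.
Import numFieldNormedType.Exports.

Local Open Scope classical_set_scope.
Local Open Scope ring_scope.

(** For n = 2 the products are Laplace transforms again.  In the coordinates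
r = s + t and v = t / s the double integral for F_{p1} F_{p2} becomes a single
Laplace integral in r whose density, up to a power of r, is an integral over v of
(1 + v)^-(S + 2) v^(p2 - theta) g(r / (1 + v)) g(r v / (1 + v)), where
g(t) = t^theta f(t) and S = p1 + p2 - 2 theta ([laplaceM_power_mul]).  With g = 1
this is the relation between the Beta and Gamma functions ([beta_integral]), so
that the quotients of Gamma functions in the statement are quotients of such
integrals without the factor in g.  After symmetrising in the two exponents, the
sign of the density of the difference is decided by a correlation inequality of
Chebyshev ([chebyshev_integral]): both the ratio
(v^a1 + v^a2) / (v^b1 + v^b2), when (a1, a2) is less spread than (b1, b2), and,
for log-concave g, the product g(r / (1 + v)) g(r v / (1 + v)) decrease as |ln v|
grows ([sympow_cross_le], [paired_log_concave_le]); for log-convex g the second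
one increases.  Hence the difference, or its opposite, is the Laplace transform
of a nonnegative function, and such transforms are completely monotonic
([cm_two_point], [cm_laplace]).

For general n, dividing F_a by Gamma(a - theta + 1) makes the coefficient
lambda disappear, and the more spread tuple is carried to the other one by
successive transfers that change two entries and keep their sum.  Each transfer
contributes a two-point difference times completely monotonic factors, and
completely monotonic functions are closed under sums and products
([cm_closure_cm], [cm_majorization]). *)

(** * Complete monotonicity *)

Section complete_monotonicity.
Context {R : realType}.
Implicit Types (h k : R -> R) (K : (R -> R) -> Prop).

Lemma near_pos (P : R -> Prop) (x : R) : 0 < x ->
  (forall y, 0 < y -> P y) -> \forall y \near x, P y.
Proof.
move=> x0 H; have : \forall y \near x, 0 < y by exact: lt_nbhsr.
by apply: filterS.
Qed.

Lemma near_is_derive h k (x l : R) : 0 < x ->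
  (forall y, 0 < y -> h y = k y) -> is_derive x 1 h l -> is_derive x 1 k l.
Proof.
move=> x0 hk; apply: near_eq_is_derive.
by apply: near_pos => // y y0; rewrite hk.
Qed.

(** Complete monotonicity is the largest property of functions that implies
nonnegativity and passes from [h] to [- h'].  Proving a closure property this way
needs no formula for higher derivatives. *)
Lemma cm_coind K :
  (forall h, K h -> (forall x : R, 0 < x -> 0 <= h x) /\
     exists2 k, K k & forall x : R, 0 < x -> is_derive x 1 h (- k x)) ->
  forall h, K h -> completely_monotonic `]0, +oo[ h.
Proof.
move=> Kstep h Kh.
have der_itr m : exists2 k, K k &
    forall x : R, 0 < x -> h^`(m)%classic x = (-1) ^+ m * k x.
  elim: m => [|m [k Kk hk]]; first by exists h => // x _; rewrite expr0 mul1r.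
  have [_ [k' Kk' dk]] := Kstep _ Kk.
  exists k' => // x x0; rewrite derive1nS derive1E.
  have dm : is_derive x 1 (fun y => (-1) ^+ m * k y) ((-1) ^+ m * - k' x).
    exact: is_deriveZ (dk x x0).
  have /(@derive_val _ _ _ _ _ _ _) -> :
      is_derive x 1 (h^`(m)%classic) ((-1) ^+ m * - k' x).
    by apply: near_is_derive dm => // y y0; rewrite hk.
  by rewrite exprSr mulrN1 mulrN mulNr.
move=> m x; rewrite /= in_itv/= andbT => x0.
have [k Kk hk] := der_itr m; have [k_ge0 [k' _ dk]] := Kstep _ Kk.
split; last by rewrite hk// mulrA -exprD addnn -signr_odd odd_double mul1r k_ge0.
have dm : is_derive x 1 (fun y => (-1) ^+ m * k y) ((-1) ^+ m * - k' x).
  exact: is_deriveZ (dk x x0).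
have dh : is_derive x 1 (h^`(m)%classic) ((-1) ^+ m * - k' x).
  by apply: near_is_derive dm => // y y0; rewrite hk.
exact: ex_derive.
Qed.

Lemma cm_step h : completely_monotonic `]0, +oo[ h ->
  (forall x : R, 0 < x -> 0 <= h x) /\
  exists2 k, completely_monotonic `]0, +oo[ k &
    forall x : R, 0 < x -> is_derive x 1 h (- k x).
Proof.
move=> cmh; split => [x x0|].
  have /(_ _)[|_] := cmh 0%N x; first by rewrite /= in_itv/= x0.
  by rewrite expr0 mul1r.
have dh (x : R) : 0 < x -> is_derive x 1 h (h^`()%classic x).
  move=> x0; have /(_ _)[|dh _] := cmh 0%N x; first by rewrite /= in_itv/= x0.
  by rewrite derive1E; exact: DeriveDef.
have cmd m (x : R) : 0 < x ->
    is_derive x 1 (fun y => - h^`(m)%classic y) (- h^`(m.+1)%classic x).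
  move=> x0; apply: is_deriveN.
  have /(_ _)[|dh' _] := cmh m x; first by rewrite /= in_itv/= x0.
  by rewrite derive1nS derive1E; exact: DeriveDef.
exists (fun x => - h^`()%classic x); last by move=> x x0; rewrite opprK; exact: dh.
have nder m (x : R) : 0 < x ->
    (fun x => - h^`()%classic x)^`(m)%classic x = - h^`(m.+1)%classic x.
  elim: m x => [//|m IH] x x0.
  rewrite derive1nS derive1E.
  apply: (@derive_val _ _ _ _ _ _ _ (_ : is_derive x 1 _ _)).
  by apply: near_is_derive (cmd m.+1 x x0) => // y y0; rewrite IH.
move=> m x; rewrite /= in_itv/= andbT => x0; split.
  apply: (@ex_derive _ _ _ _ _ _ _ (_ : is_derive x 1 _ (- h^`(m.+2)%classic x))).
  by apply: near_is_derive (cmd m.+1 x x0) => // y y0; rewrite nder.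
have /(_ _)[|_] := cmh m.+1 x; first by rewrite /= in_itv/= x0.
by rewrite nder// exprS mulN1r mulrN mulNr.
Qed.

Lemma cm_ext h k : (forall x : R, 0 < x -> h x = k x) ->
  completely_monotonic `]0, +oo[ h -> completely_monotonic `]0, +oo[ k.
Proof.
move=> hk cmh.
apply: (@cm_coind (fun k => exists2 h, completely_monotonic `]0, +oo[ h &
  forall x : R, 0 < x -> h x = k x)); last by exists h.
move=> {cmh hk h}k [h /cm_step[h0 [h' cmh' dh]] hk]; split => [x x0|].
  by rewrite -hk// h0.
exists h'; first by exists h'.
by move=> x x0; exact: near_is_derive (dh x x0).
Qed.

Inductive cm_closure : (R -> R) -> Prop :=
| cmc_base h : completely_monotonic `]0, +oo[ h -> cm_closure h
| cmc_add h k : cm_closure h -> cm_closure k -> cm_closure (fun x => h x + k x)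
| cmc_mul h k : cm_closure h -> cm_closure k -> cm_closure (fun x => h x * k x).

(** By the Leibniz rule the closure under sums and products is stable under
[h |-> - h'], so coinduction applies to it. *)
Lemma cm_closure_cm h : cm_closure h -> completely_monotonic `]0, +oo[ h.
Proof.
apply: cm_coind => {}h; elim => {h}[h /cm_step[h0 [k cmk dh]]|h k|h k].
- by split=> //; exists k => //; exact: cmc_base.
- move=> _ [h0 [h' ch' dh]] _ [k0 [k' ck' dk]]; split.
    by move=> x x0; rewrite addr_ge0// ?h0 ?k0.
  exists (fun x => h' x + k' x); first exact: cmc_add.
  move=> x x0; have := is_deriveD (dh x x0) (dk x x0).
  by rewrite -opprD.
- move=> ch [h0 [h' ch' dh]] ck [k0 [k' ck' dk]]; split.
    by move=> x x0; rewrite mulr_ge0// ?h0 ?k0.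
  exists (fun x => h' x * k x + h x * k' x).
    by apply: cmc_add; apply: cmc_mul.
  move=> x x0.
  have -> : - (h' x * k x + h x * k' x) = h x *: - k' x + k x *: - h' x.
    by rewrite /GRing.scale/=; ring.
  exact: is_deriveM (dh x x0) (dk x x0).
Qed.

Lemma cm_add h k : completely_monotonic `]0, +oo[ h ->
  completely_monotonic `]0, +oo[ k ->
  completely_monotonic `]0, +oo[ (fun x => h x + k x).
Proof. by move=> ? ?; apply/cm_closure_cm/cmc_add; exact: cmc_base. Qed.

Lemma cm_mul h k : completely_monotonic `]0, +oo[ h ->
  completely_monotonic `]0, +oo[ k ->
  completely_monotonic `]0, +oo[ (fun x => h x * k x).
Proof. by move=> ? ?; apply/cm_closure_cm/cmc_mul; exact: cmc_base. Qed.

Lemma cm_cst (a : R) : 0 <= a -> completely_monotonic `]0, +oo[ (fun=> a).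
Proof.
move=> a0; apply: (@cm_coind (fun h => exists2 b : R, 0 <= b & h = fun=> b));
  last by exists a.
move=> h [b b0 ->]; split=> //; exists (fun=> 0); first by exists 0.
by move=> x x0; rewrite oppr0; exact: is_derive_cst.
Qed.

End complete_monotonicity.

(** * Laplace transforms of nonnegative functions *)

(** Integrals that occur inside algebraic identities are locked, so that unequal
ones are told apart by their arguments instead of being unfolded. *)
HB.lock Definition laplace (R : realType) (phi : R -> R) (x : R) : R :=
  \int[lebesgue_measure]_(t in `]0, +oo[) (phi t * expR (- (x * t))).

Section laplace_transform.
Context {R : realType}.
Implicit Types (phi psi : R -> R).

Notation mu := (@lebesgue_measure R).

Definition laplaceable phi := (forall t : R, 0 < t -> 0 <= phi t) /\
  forall x : R, 0 < x ->
    mu.-integrable `]0, +oo[ (EFin \o (fun t => phi t * expR (- (x * t)))).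

Lemma laplaceE phi (x : R) :
  laplace phi x = \int[mu]_(t in `]0, +oo[) (phi t * expR (- (x * t))).
Proof. by rewrite laplace.unlock. Qed.

Lemma pos_itvE (t : R) : `]0, +oo[%classic t = (0 < t) :> Prop.
Proof. by rewrite /= in_itv/= andbT. Qed.

Lemma measurable_expRN (x : R) (A : set R) :
  measurable_fun A (fun t : R => expR (- (x * t))).
Proof.
apply: measurable_funTS; apply: measurableT_comp => //.
by apply: measurableT_comp => //; exact: measurable_funM.
Qed.

Lemma laplaceable_measurable phi :
  laplaceable phi -> measurable_fun (`]0, +oo[ : set R) phi.
Proof.
move=> [_ /(_ 1 ltr01)/measurable_int/measurable_EFinP mphi].
apply: (@eq_measurable_fun _ _ _ _ _
    (fun t => (phi t * expR (- (1 * t))) * expR (1 * t))).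
  by move=> t _; rewrite -mulrA -expRD addNr expR0 mulr1.
apply: measurable_funM => //.
by apply: measurable_funTS; apply: measurableT_comp => //; exact: measurable_funM.
Qed.

(** Multiplication by [t] costs half of the exponential decay:
[x t / 2 * exp (- x t / 2) <= 1]. *)
Lemma laplaceable_mulid phi : laplaceable phi -> laplaceable (fun t => t * phi t).
Proof.
move=> lphi; have [phi0 iphi] := lphi; split => [t t0|x x0].
  by rewrite mulr_ge0 ?phi0// ltW.
have mD : measurable (`]0, +oo[ : set (measurableTypeR R)) by [].
apply: (le_integrable mD _ _ (integrableZl mD (2 / x) (iphi (x / 2) _)))=> //.
- apply/measurable_EFinP; apply: measurable_funM; last exact: measurable_expRN.
  by apply: measurable_funM => //; exact: laplaceable_measurable.
- move=> t; rewrite pos_itvE => t0; rewrite lee_fin.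
  rewrite !ger0_norm ?mulr_ge0 ?expR_ge0 ?phi0 ?invr_ge0 ?(ltW t0) ?(ltW x0)//.
  have -> : expR (- (x * t)) = expR (- (x / 2 * t)) * expR (- (x / 2 * t)).
    by rewrite -expRD; congr expR; field.
  have e1 : x / 2 * t * expR (- (x / 2 * t)) <= 1.
    rewrite expRN ler_pdivrMr ?expR_gt0// mul1r.
    by apply: le_trans (expR_ge1Dx _); rewrite lerDr.
  have -> : t * phi t * (expR (- (x / 2 * t)) * expR (- (x / 2 * t))) =
      2 / x * (phi t * expR (- (x / 2 * t))) * (x / 2 * t * expR (- (x / 2 * t))).
    by field; rewrite gt_eqF.
  by rewrite ler_piMr// ?mulr_ge0 ?expR_ge0 ?phi0 ?invr_ge0 ?(ltW t0) ?(ltW x0).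
- by rewrite divr_gt0.
Qed.

(** For [y] above [x / 2] the derivative of the integrand in [y] is dominated by
its value at [x / 2]. *)
Lemma is_derive_laplace phi (x : R) : laplaceable phi -> 0 < x ->
  is_derive x 1 (laplace phi) (- laplace (fun t => t * phi t) x).
Proof.
move=> lphi x0; have [phi0 iphi] := lphi.
pose F x t := phi t * expR (- (x * t)).
have dF (y t : R) : is_derive y 1 (F ^~ t) (- (t * phi t * expR (- (y * t)))).
  have dl : is_derive y 1 (fun z : R => - (z * t)) (- t).
    have -> : (fun z : R => - (z * t)) = (- t) *: (@id R).
      by apply/funext => z; rewrite /= mulrC -mulNr.
    by rewrite -[X in is_derive _ _ _ X]mulr1; exact: is_deriveZ.
  have de := @is_derive1_comp _ expR (fun z => - (z * t)) y _ _ (is_derive_expR _) dl.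
  have -> : - (t * phi t * expR (- (y * t))) = phi t *: (expR (- (y * t)) * - t).
    by rewrite /GRing.scale/=; ring.
  exact: is_deriveZ.
have dFE (y t : R) : partial1of2 F y t = - (t * phi t * expR (- (y * t))).
  by rewrite partial1of2E; apply: derive_val.
pose G (t : R) := `| t * phi t * expR (- (x / 2 * t)) |.
have iG : mu.-integrable `]0, +oo[ (EFin \o G).
  apply: integrable_norm.
  by apply: (laplaceable_mulid lphi).2; rewrite divr_gt0.
have hx : x \in `](x / 2), (x + 1)[%R.
  by rewrite in_itv/=; apply/andP; split; lra.
have iF y : `](x / 2), (x + 1)[%classic y -> mu.-integrable `]0, +oo[ (EFin \o F y).
  by rewrite /= in_itv/= => /andP[y1 _]; apply: iphi; lra.
have derF y t : `](x / 2), (x + 1)[%classic y -> `]0, +oo[%classic t ->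
    derivable (F ^~ t) y 1.
  by move=> _ _; have [] := dF y t.
have G0 t : 0 <= G t by exact: normr_ge0.
have GF y t : `](x / 2), (x + 1)[%classic y -> `]0, +oo[%classic t ->
    `|partial1of2 F y t| <= G t.
  rewrite pos_itvE /= in_itv/= => /andP[y1 _] t0.
  rewrite dFE normrN /G !normrM ler_wpM2l// !ger0_norm ?expR_ge0// ler_expR.
  by rewrite lerN2 ler_wpM2r// ltW.
have mD : measurable (`]0, +oo[%classic : set (measurableTypeR R)) by [].
have lE : laplace phi = fun y => \int[mu]_(t in `]0, +oo[) F y t.
  by apply/funext => y; rewrite laplaceE.
have dL := derivable_under_integral mD hx iF derF G0 iG GF.
have eL := differentiation_under_integral mD hx iF derF G0 iG GF.
rewrite lE; apply: DeriveDef; first exact: dL.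
rewrite -derive1E eL laplaceE.
under eq_Rintegral do rewrite dFE -mulN1r.
rewrite RintegralZl ?mulN1r//.
exact: (laplaceable_mulid lphi).2.
Qed.

Lemma laplace_ge0 phi (x : R) : laplaceable phi -> 0 <= laplace phi x.
Proof.
move=> [phi0 _]; rewrite laplaceE; apply: Rintegral_ge0 => t; rewrite pos_itvE => t0.
by rewrite mulr_ge0 ?expR_ge0 ?phi0.
Qed.

Lemma eq_laplace phi psi (x : R) :
  (forall t, 0 < t -> phi t = psi t) -> laplace phi x = laplace psi x.
Proof.
move=> h; rewrite !laplaceE; apply: eq_Rintegral => t.
by rewrite inE pos_itvE => t0; rewrite h.
Qed.

(** Laplace transforms are closed under [h |-> - h']: the density is multiplied
by [t]. *)
Lemma cm_laplace phi : laplaceable phi -> completely_monotonic `]0, +oo[ (laplace phi).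
Proof.
move=> lphi.
apply: (@cm_coind _ (fun h => exists2 phi, laplaceable phi & h = laplace phi));
  last by exists phi.
move=> {lphi phi}_ [phi lphi ->]; split; first by move=> x x0; exact: laplace_ge0.
exists (laplace (fun t => t * phi t)).
  by exists (fun t => t * phi t) => //; exact: laplaceable_mulid.
by move=> x x0; exact: is_derive_laplace.
Qed.

End laplace_transform.

(** * Convergence of the Gamma integral *)

Section gamma_integrability.
Context {R : realType}.
Notation mu := (@lebesgue_measure R).

(** The primitive [t^c / c] is bounded, so the integrals over [[1 / (n + 1), 1]]
stay below [1 / c]; monotone convergence gives the integral up to [0]. *)
Lemma integrable_powR_unit (c : R) : 0 < c ->
  mu.-integrable `]0, 1] (EFin \o (fun t : R => t `^ (c - 1))).
Proof.
move=> c0; apply/integrableP; split.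
  by apply/measurable_EFinP; apply: measurable_funTS; exact: measurable_powR.
pose F (n : nat) : set R := `[n.+1%:R^-1, 1]%classic.
have FE : `]0%R, 1%R]%classic = \bigcup_n F n.
  apply/seteqP; split => [t|t [n _]]; rewrite /F /= !in_itv/= => /andP[t0 t1].
    exists (Num.truncn t^-1) => //; rewrite /F/= in_itv/= t1 andbT.
    rewrite -[leRHS]invrK lef_pV2 ?posrE ?invr_gt0//.
    by rewrite ltW// truncnS_gt.
  by rewrite t1 andbT (lt_le_trans _ t0).
have Fpos n (t : R) : F n t -> 0 < t.
  by rewrite /F/= in_itv/= => /andP[t0 _]; exact: lt_le_trans t0.
have dp (t : R) : 0 < t -> is_derive t 1 (fun t => c^-1 * t `^ c) (t `^ (c - 1)).
  move=> t0; have -> : t `^ (c - 1) = c^-1 *: (c * t `^ (c - 1)).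
    by rewrite /GRing.scale/= mulrA mulVf ?mul1r// gt_eqF.
  exact: is_deriveZ (is_derive1_powR c t0).
have cp d (t : R) : 0 < t -> {for t, continuous (fun t : R => t `^ d)}.
  move=> t0; apply: differentiable_continuous; apply/derivable1_diffP.
  by have [] := is_derive1_powR d t0.
have IF n : (\int[mu]_(t in F n) (t `^ (c - 1))%:E <= (c^-1)%:E)%E.
  have [n1|n1] := ltP (n.+1%:R^-1 : R) 1; last first.
    have -> : F n = [set 1].
      apply/seteqP; split => [t|t ->]; rewrite /F/= in_itv/=.
        move=> /andP[t1 t2]; apply/eqP; rewrite eq_le t2 /=.
        exact: le_trans t1.
      by rewrite lexx andbT invf_le1// ler1n.
    by rewrite integral_set1 lee_fin invr_ge0 ltW.
  rewrite (@continuous_FTC2 _ _ (fun t => c^-1 * t `^ c))//.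
  - rewrite -EFinB lee_fin powR1 mulr1 gerBl mulr_ge0 ?powR_ge0// invr_ge0 ltW//.
  - apply: derivable_within_continuous => t /Fpos t0.
    by have [] := is_derive1_powR (c - 1) t0.
  - split.
    + move=> t; rewrite in_itv/= => /andP[t0 _].
      by have [] := dp t (lt_trans _ t0).
    + apply: cvg_at_right_filter; apply: cvgMr; exact: cp.
    + apply: cvg_at_left_filter; apply: cvgMr; exact: cp.
  - move=> t; rewrite in_itv/= => /andP[t0 _].
    by rewrite derive1E; apply: (@derive_val _ _ _ _ _ _ _ (dp t (lt_trans _ t0))).
under eq_integral => t _ do rewrite /comp gee0_abs ?lee_fin ?powR_ge0//.
rewrite FE; apply: (@le_lt_trans _ _ (c^-1)%:E); last exact: ltry.
have cvgI : (\int[mu]_(t in F n) (t `^ (c - 1))%:E @[n --> \oo] -->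
    \int[mu]_(t in \bigcup_n F n) (t `^ (c - 1))%:E)%E.
  apply: ge0_nondecreasing_set_cvg_integral.
  - apply/nondecreasing_seqP => n; rewrite subsetEset => t; rewrite /F/= !in_itv/=.
    move=> /andP[t1 ->]; rewrite andbT (le_trans _ t1)//.
    by rewrite lef_pV2 ?posrE// ler_nat.
  - by move=> n; rewrite /F.
  - by move=> n; apply/measurable_EFinP; apply: measurable_funTS; exact: measurable_powR.
  - by move=> n t _; rewrite lee_fin powR_ge0.
rewrite -(cvg_lim _ cvgI)//; apply: lime_le; last by apply: nearW => n; exact: IF.
by apply/cvg_ex; eexists; exact: cvgI.
Qed.

Lemma integrable_expRN (x : R) : 0 < x ->
  mu.-integrable `]0, +oo[ (EFin \o (fun t : R => expR (- (x * t)))).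
Proof.
move=> x0.
have mD : measurable (`]0, +oo[ : set (measurableTypeR R)) by [].
have := integrableZl mD x^-1 (integrableS measurableT mD (@subsetT _ _)
  (integrable_exponential_pdf x0)).
apply: eq_integrable => // t; rewrite inE pos_itvE => t0.
rewrite /= -EFinM; congr EFin; rewrite /exponential_pdf patchE mem_set/=; last first.
  by rewrite in_itv/= (ltW t0).
by rewrite mulrA mulVf ?gt_eqF// mul1r mulNr.
Qed.

(** For [-1 < a <= 0] the integrand is below [t^a] on the unit interval and below
the exponential elsewhere; multiplications by [t] reach the other exponents. *)
Lemma laplaceable_powR (a : R) : -1 < a -> laplaceable (fun t : R => t `^ a).
Proof.
have mD : measurable (`]0, +oo[ : set (measurableTypeR R)) by [].
move=> a1.
have [n an] : exists n : nat, a <= n%:R.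
  by exists (Num.truncn `|a|).+1; rewrite (le_trans (ler_norm _))// ltW// truncnS_gt.
elim: n a a1 an => [|n IH] a a1 an.
  split => [t _|x x0]; first exact: powR_ge0.
  have i1 : mu.-integrable `]0, +oo[ (EFin \o (fun t : R => t `^ a) \_ `]0, 1]).
    rewrite -restrict_EFin; apply/integrable_restrict => //.
    rewrite (_ : _ `&` _ = `]0, 1]%classic); last first.
      apply/seteqP; split => [t [_]//|t] /=; rewrite !in_itv/= => /andP[-> ->] //.
    have -> : a = (a + 1) - 1 by ring.
    by apply: integrable_powR_unit; lra.
  apply: (le_integrable mD _ _ (integrableD mD i1 (integrable_expRN x0))).
    apply/measurable_EFinP; apply: measurable_funM; last exact: measurable_expRN.
    by apply: measurable_funTS; exact: measurable_powR.
  move=> t; rewrite pos_itvE => t0.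
  rewrite [X in (_ <= `|X|)%E](_ : _ =
    (((fun t : R => t `^ a) \_ `]0, 1]) t + expR (- (x * t)))%:E)// lee_fin.
  have q0 : 0 <= ((fun t : R => t `^ a) \_ `]0, 1]) t.
    by rewrite patchE; case: ifPn => // _; rewrite powR_ge0.
  rewrite !ger0_norm ?mulr_ge0 ?addr_ge0 ?powR_ge0 ?expR_ge0//.
  rewrite patchE; case: ifPn => [_|].
    rewrite -[leLHS]addr0 lerD ?expR_ge0// ler_piMr ?powR_ge0//.
    by rewrite -expR0 ler_expR oppr_le0 mulr_ge0 ?ltW.
  rewrite notin_setE /= in_itv/= t0 /= => /negP; rewrite -ltNge => t1.
  rewrite add0r ler_piMl ?expR_ge0//.
  by rewrite -(powRr0 t) ler_powR// ltW.
have [a0|a0] := leP a 0.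
  by apply: IH => //; rewrite (le_trans a0)// ler0n.
have /laplaceable_mulid : laplaceable (fun t : R => t `^ (a - 1)).
  by apply: IH; [lra|rewrite lerBlDr natr1].
move=> [l0 li]; split => [t _|x x0]; first exact: powR_ge0.
apply: eq_integrable (li x x0) => // t; rewrite inE pos_itvE => t0.
by rewrite /= mulr_powRB1// ltW.
Qed.

Lemma Gamma_laplace (a : R) : Gamma (a + 1) = laplace (fun t : R => t `^ a) 1.
Proof.
by rewrite /Gamma laplaceE; apply: eq_Rintegral => t _; rewrite addrK mul1r.
Qed.

End gamma_integrability.

(** * Products of Laplace transforms *)

Section polar_tonelli.
Context {R : realType}.
Notation mu := (@lebesgue_measure R).
Local Open Scope ereal_scope.

Let mD : measurable (`]0%R, +oo[ : set (measurableTypeR R)).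
Proof. by []. Qed.

Lemma lebesgue_measure_dilation (c : R) (c0 : (0 < c)%R) (A : set (measurableTypeR R)) :
  measurable A ->
  pushforward (mscale (NngNum (ltW c0)) mu) ( *%R c : _ -> measurableTypeR R) A = mu A.
Proof.
move=> mA; apply/esym/lebesgue_measure_unique => //= _ [[a b]] _ <-.
rewrite /pushforward /mscale /=.
rewrite (_ : _ @^-1` _ = `](a / c)%R, (b / c)%R]%classic); last first.
  apply/seteqP; split=> t /=; rewrite !in_itv/=;
    by rewrite ltr_pdivrMr// ler_pdivlMr// ![(t * c)%R]mulrC.
rewrite !lebesgue_measure_itv/= !lte_fin ltr_pM2r ?invr_gt0//.
case: ifPn => _; last by rewrite mule0.
by rewrite -!EFinD -EFinM; congr EFin; field; rewrite gt_eqF.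
Qed.

Lemma ge0_integral_dilation (c : R) (h : R -> R) : (0 < c)%R ->
  measurable_fun setT h -> (forall t, 0 <= h t)%R ->
  \int[mu]_(t in `]0%R, +oo[) (h t)%:E =
  \int[mu]_(v in `]0%R, +oo[) (c * h (c * v))%:E.
Proof.
move=> c0 mh h0.
have mhc : measurable_fun setT (fun v => h (c * v)%R).
  by apply: measurableT_comp => //; exact: mulrl_measurable.
transitivity (\int[pushforward (mscale (NngNum (ltW c0)) mu)
    ( *%R c : measurableTypeR R -> measurableTypeR R)]_(t in `]0%R, +oo[) (h t)%:E).
  by apply: eq_measure_integral => //= A mA _; exact/esym/lebesgue_measure_dilation.
rewrite ge0_integral_pushforward//=; last 2 first.
- by apply/measurable_EFinP; exact: measurable_funTS.
- by move=> t _; rewrite lee_fin.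
rewrite (_ : _ @^-1` _ = `]0%R, +oo[%classic); last first.
  by apply/seteqP; split=> t /=; rewrite !in_itv/= !andbT pmulr_rgt0.
rewrite ge0_integral_mscale//=; last 2 first.
- by apply/measurable_EFinP; exact: measurable_funTS.
- by move=> t _; rewrite lee_fin.
rewrite -ge0_integralZl_EFin//; last 3 first.
- by move=> t _; rewrite lee_fin.
- by apply/measurable_EFinP; exact: measurable_funTS.
- exact: ltW.
Qed.

Lemma quadrant_tonelli (H : R * R -> R) : measurable_fun setT H ->
  (forall z, 0 <= H z)%R ->
  \int[mu]_(x in `]0%R, +oo[) \int[mu]_(y in `]0%R, +oo[) (H (x, y))%:E =
  \int[mu]_(y in `]0%R, +oo[) \int[mu]_(x in `]0%R, +oo[) (H (x, y))%:E.
Proof.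
move=> mH H0; pose D : set R := `]0%R, +oo[%classic.
pose H' (z : R * R) := ((\1_D z.1 * \1_D z.2) * H z)%:E.
have mH' : measurable_fun setT H'.
  apply/measurable_EFinP; apply: measurable_funM => //; apply: measurable_funM.
    by apply: measurableT_comp => //; exact: measurable_indic.
  by apply: measurableT_comp => //; exact: measurable_indic.
have H'0 z : 0 <= H' z by rewrite lee_fin !mulr_ge0.
have := @fubini_tonelli _ _ _ _ _ mu mu H' mH' H'0.
have E1 (F G : R -> \bar R) : (forall x, D x -> F x = G x) ->
    (forall x, ~ D x -> G x = 0) -> \int[mu]_(x in D) F x = \int[mu]_x G x.
  move=> FG G0; rewrite integral_mkcond; apply: eq_integral => x _.
  rewrite patchE; case: ifPn; rewrite ?inE ?notin_setE; first exact: FG.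
  by move=> /G0.
move=> E2; rewrite (E1 _ (fun x => \int[mu]_y H' (x, y))); last 2 first.
- move=> x Dx; apply: (E1 _ _) => y Dy; rewrite /H'/= !indicE (mem_set Dx).
    by rewrite (mem_set Dy) !mul1r.
  by rewrite (memNset Dy) mulr0 mul0r.
- move=> x Dx; rewrite integral0_eq// => y _.
  by rewrite /H'/= !indicE (memNset Dx) !mul0r.
rewrite E2; apply/esym; apply: (E1 _ _).
- move=> x Dx; apply: (E1 _ _) => y Dy; rewrite /H'/= !indicE (mem_set Dx).
    by rewrite (mem_set Dy) !mul1r.
  by rewrite (memNset Dy) !mul0r.
- move=> x Dx; rewrite integral0_eq// => y _.
  by rewrite /H'/= !indicE (memNset Dx) mulr0 mul0r.
Qed.

Lemma measurable_quadrant_section (H : R * R -> R) : measurable_fun setT H ->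
  (forall z, 0 <= H z)%R ->
  measurable_fun setT (fun x => \int[mu]_(y in `]0%R, +oo[) (H (x, y))%:E).
Proof.
move=> mH H0; pose D : set R := `]0%R, +oo[%classic.
pose H' (z : R * R) := (\1_D z.2 * H z)%:E.
have mH' : measurable_fun setT H'.
  apply/measurable_EFinP; apply: measurable_funM => //.
  by apply: measurableT_comp => //; exact: measurable_indic.
have H'0 z : 0 <= H' z by rewrite lee_fin !mulr_ge0.
have := @measurable_fun_fubini_tonelli_F _ _ _ _ _ mu H' mH' H'0.
apply: eq_measurable_fun => x _; rewrite /fubini_F [RHS]integral_mkcond.
apply: eq_integral => y _; rewrite /H' patchE indicE.
by case: ifPn => _; rewrite ?mul1r ?mul0r.
Qed.

Let q (v : R) : R := ((1 + v) `^ (-1))%R.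

Let measurable_q d (T : measurableType d) (g : T -> R) :
  measurable_fun setT g -> measurable_fun setT (fun z => q (g z)).
Proof.
move=> mg; apply: (measurableT_comp (@measurable_powR R (-1))).
exact: measurable_funD.
Qed.

(** The change of variables [s = r / (1 + v)], [t = r v / (1 + v)] on the
quadrant, that is [r = s + t] and [v = t / s], is obtained from two dilations in
one variable: first [t = s v] for fixed [s], then [s = r / (1 + v)] for fixed
[v].  The function [1 / (1 + v)] is written as a power, and [r] under an absolute
value, to be measurable and nonnegative on the whole line. *)
Lemma polar_tonelli (H : R * R -> R) : measurable_fun setT H ->
  (forall z, 0 <= H z)%R ->
  \int[mu]_(s in `]0%R, +oo[) \int[mu]_(t in `]0%R, +oo[) (H (s, t))%:E =
  \int[mu]_(r in `]0%R, +oo[) \int[mu]_(v in `]0%R, +oo[)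
    (`|r| * q v ^+ 2 * H (r * q v, r * q v * v))%:E.
Proof.
move=> mH H0.
pose K (z : R * R) := (`|z.1| * H (z.1, z.1 * z.2))%R.
have mK : measurable_fun setT K.
  apply: measurable_funM; first by apply: measurableT_comp => //; exact: measurableT_comp.
  apply: measurableT_comp => //; apply: measurable_fun_pair => //.
  exact: measurable_funM.
have K0 z : (0 <= K z)%R by rewrite mulr_ge0.
transitivity (\int[mu]_(s in `]0%R, +oo[) \int[mu]_(v in `]0%R, +oo[) (K (s, v))%:E).
  apply: eq_integral => s; rewrite inE pos_itvE => s0.
  rewrite (@ge0_integral_dilation s (fun t => H (s, t)))//; last exact: measurableT_comp.
  by apply: eq_integral => v _; rewrite /K/= gtr0_norm.
rewrite (quadrant_tonelli mK K0).
pose K2 (z : R * R) := (`|z.1| * q z.2 ^+ 2 * H (z.1 * q z.2, z.1 * q z.2 * z.2))%R.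
have mq : measurable_fun setT (fun z : R * R => q z.2) by exact: measurable_q.
have mK2 : measurable_fun setT K2.
  apply: measurable_funM.
    apply: measurable_funM; first by apply: measurableT_comp => //; exact: measurableT_comp.
    exact: measurable_funX.
  apply: measurableT_comp => //; apply: measurable_fun_pair => //.
    exact: measurable_funM.
  by apply: measurable_funM => //; exact: measurable_funM.
have K20 z : (0 <= K2 z)%R by rewrite !mulr_ge0 ?powR_ge0.
rewrite [RHS](quadrant_tonelli mK2 K20).
apply: eq_integral => v; rewrite inE pos_itvE => v0.
have q0 : (0 < q v)%R by rewrite powR_gt0// addr_gt0.
rewrite (@ge0_integral_dilation (q v) (fun s => K (s, v)))//; last exact: measurableT_comp.
apply: eq_integral => r _; congr EFin; rewrite /K/K2/= normrM (gtr0_norm q0).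
by rewrite [(q v * r)%R]mulrC; ring.
Qed.

End polar_tonelli.

Section laplace_convolution.
Context {R : realType}.
Notation mu := (@lebesgue_measure R).
Implicit Types phi psi : R -> R.

Definition polar_kernel phi psi (r v : R) : R :=
  r * (1 + v) `^ (-1) ^+ 2 *
    (phi (r * (1 + v) `^ (-1)) * psi (r * (1 + v) `^ (-1) * v)).

(** The convolution of [phi] and [psi] at [r], written as an integral over the
ratio of the two summands of [r]. *)
Definition polar_conv phi psi (r : R) : R :=
  \int[mu]_(v in `]0%R, +oo[) polar_kernel phi psi r v.

Lemma polar_splitE (r v : R) : 0 < v ->
  r * (1 + v) `^ (-1) + r * (1 + v) `^ (-1) * v = r.
Proof.
move=> v0; rewrite powR_inv1; last by rewrite addr_ge0// ltW.
by field; rewrite gt_eqF// addr_gt0.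
Qed.

Lemma measurable_polar_kernel phi psi :
  measurable_fun setT phi -> measurable_fun setT psi ->
  measurable_fun setT (fun z : R * R => polar_kernel phi psi z.1 z.2).
Proof.
move=> mphi mpsi.
have mq : measurable_fun setT (fun z : R * R => (1 + z.2) `^ (-1)).
  by apply: (measurableT_comp (@measurable_powR R (-1))); exact: measurable_funD.
have mrq : measurable_fun setT (fun z : R * R => z.1 * (1 + z.2) `^ (-1)).
  exact: measurable_funM.
apply: measurable_funM.
  by apply: measurable_funM => //; exact: measurable_funX.
apply: measurable_funM; first exact: measurableT_comp.
by apply: measurableT_comp => //; exact: measurable_funM.
Qed.

(** The extended-real form of the convolution theorem, in which the inner
integral may be infinite. *)
Lemma laplace_polar_integral phi psi (x : R) :
  laplaceable phi -> laplaceable psi ->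
  measurable_fun setT phi -> measurable_fun setT psi ->
  (forall t, 0 <= phi t) -> (forall t, 0 <= psi t) -> 0 < x ->
  (laplace phi x * laplace psi x)%:E =
  (\int[mu]_(r in `]0%R, +oo[) ((expR (- (x * r)))%:E *
     \int[mu]_(v in `]0%R, +oo[) (polar_kernel phi psi r v)%:E))%E.
Proof.
move=> lphi lpsi mphi mpsi phi0 psi0 x0.
have mD : measurable (`]0, +oo[ : set (measurableTypeR R)) by [].
have me : measurable_fun setT (fun t : R => expR (- (x * t))) by exact: measurable_expRN.
pose H (z : R * R) := phi z.1 * expR (- (x * z.1)) * (psi z.2 * expR (- (x * z.2))).
have mH : measurable_fun setT H.
  apply: measurable_funM; apply: measurable_funM.
  - exact: measurableT_comp.
  - by apply: (measurableT_comp me).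
  - exact: measurableT_comp.
  - by apply: (measurableT_comp me).
have H0 z : 0 <= H z by rewrite !mulr_ge0 ?expR_ge0.
have LE chi : laplaceable chi ->
    (\int[mu]_(t in `]0%R, +oo[) (chi t * expR (- (x * t)))%:E = (laplace chi x)%:E)%E.
  move=> [_ /(_ _ x0) ichi]; rewrite laplaceE /Rintegral fineK//.
  exact: integrable_fin_num.
transitivity (\int[mu]_(s in `]0%R, +oo[) \int[mu]_(t in `]0%R, +oo[) (H (s, t))%:E)%E.
  under [RHS]eq_integral => s _.
    under eq_integral do rewrite /H /= EFinM.
    rewrite ge0_integralZl_EFin//; last 3 first.
    - by move=> t _; rewrite lee_fin mulr_ge0 ?expR_ge0.
    - apply/measurable_EFinP; apply: measurable_funTS; exact: measurable_funM.
    - by rewrite mulr_ge0 ?expR_ge0.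
    rewrite LE// muleC.
    over.
  rewrite ge0_integralZl_EFin//; last 3 first.
  - by move=> t _; rewrite lee_fin mulr_ge0 ?expR_ge0.
  - apply/measurable_EFinP; apply: measurable_funTS; exact: measurable_funM.
  - exact: laplace_ge0.
  by rewrite LE// -EFinM mulrC.
rewrite polar_tonelli//; apply: eq_integral => r; rewrite inE pos_itvE => r0.
rewrite -ge0_integralZl_EFin//; last 2 first.
- move=> v; rewrite pos_itvE => v0; rewrite lee_fin.
  by rewrite !mulr_ge0// ?powR_ge0// ltW.
- apply/measurable_EFinP; apply: measurable_funTS.
  exact: (measurableT_comp (measurable_polar_kernel mphi mpsi)
    (measurable_pair1 r)).
apply: eq_integral => v; rewrite inE pos_itvE => v0; rewrite -EFinM; congr EFin.
rewrite /H/polar_kernel/= gtr0_norm//.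
have <- : expR (- (x * (r * (1 + v) `^ (-1)))) * expR (- (x * (r * (1 + v) `^ (-1) * v)))
   = expR (- (x * r)).
  by rewrite -expRD -opprD -mulrDr polar_splitE.
by ring.
Qed.

Lemma laplace_polar_conv phi psi :
  laplaceable phi -> laplaceable psi ->
  measurable_fun setT phi -> measurable_fun setT psi ->
  (forall t, 0 <= phi t) -> (forall t, 0 <= psi t) ->
  (forall r, 0 < r ->
     mu.-integrable `]0, +oo[ (EFin \o polar_kernel phi psi r)) ->
  laplaceable (polar_conv phi psi) /\
  forall x, 0 < x -> laplace phi x * laplace psi x = laplace (polar_conv phi psi) x.
Proof.
move=> lphi lpsi mphi mpsi phi0 psi0 ik.
have mD : measurable (`]0, +oo[ : set (measurableTypeR R)) by [].
have k0 r v : 0 < r -> 0 <= polar_kernel phi psi r v.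
  by move=> r0; rewrite !mulr_ge0 ?powR_ge0 ?(ltW r0).
have c0 r : 0 < r -> 0 <= polar_conv phi psi r.
  by move=> r0; apply: Rintegral_ge0 => v _; exact: k0.
have cE r : 0 < r -> (\int[mu]_(v in `]0%R, +oo[) (polar_kernel phi psi r v)%:E)%E =
    (polar_conv phi psi r)%:E.
  move=> r0; rewrite /polar_conv /Rintegral fineK//.
  exact: integrable_fin_num (ik _ r0).
have mc : measurable_fun (`]0, +oo[ : set R) (polar_conv phi psi).
  apply/measurable_EFinP.
  pose H (z : R * R) := `| polar_kernel phi psi z.1 z.2 |.
  have mH : measurable_fun setT H.
    by apply: measurableT_comp => //; exact: measurable_polar_kernel.
  have := measurable_funTS (measurable_quadrant_section mH (fun z => normr_ge0 _)).
  move=> /(_ `]0, +oo[%classic); apply: eq_measurable_fun => r.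
  rewrite inE pos_itvE => r0.
  rewrite /= -cE//; apply: eq_integral => v _; rewrite /H/= ger0_norm//; exact: k0.
have L x : 0 < x -> (\int[mu]_(r in `]0%R, +oo[)
    (polar_conv phi psi r * expR (- (x * r)))%:E = (laplace phi x * laplace psi x)%:E)%E.
  move=> x0; rewrite laplace_polar_integral//; apply: eq_integral => r.
  by rewrite inE pos_itvE => r0; rewrite cE// -EFinM mulrC.
split; last by move=> x x0; rewrite [RHS]laplaceE /Rintegral L.
split=> // x x0; apply/integrableP; split.
  by apply/measurable_EFinP; apply: measurable_funM => //; exact: measurable_expRN.
rewrite (_ : (\int[_]_(_ in _) _)%E = (laplace phi x * laplace psi x)%:E) ?ltry//.
rewrite -L//; apply: eq_integral => r; rewrite inE pos_itvE => r0 /=.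
by rewrite ger0_norm// mulr_ge0 ?expR_ge0 ?c0.
Qed.

End laplace_convolution.

(** * The correlation inequality *)

Section chebyshev.
Context d (T : measurableType d) (R : realType) (mu : {measure set T -> \bar R}).
Variables (D : set T) (mD : measurable D).
Implicit Types f A B G : T -> R.

Lemma Rintegral_lin2 (c1 c2 : R) f1 f2 :
  mu.-integrable D (EFin \o f1) -> mu.-integrable D (EFin \o f2) ->
  mu.-integrable D (EFin \o (fun v => c1 * f1 v + c2 * f2 v)) /\
  \int[mu]_(v in D) (c1 * f1 v + c2 * f2 v) =
    c1 * \int[mu]_(v in D) f1 v + c2 * \int[mu]_(v in D) f2 v.
Proof.
move=> i1 i2.
have j1 : mu.-integrable D (EFin \o (fun v => c1 * f1 v)) := integrableZl mD c1 i1.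
have j2 : mu.-integrable D (EFin \o (fun v => c2 * f2 v)) := integrableZl mD c2 i2.
split; first exact: (integrableD mD j1 j2).
by rewrite RintegralD// !RintegralZl.
Qed.

(** The double integral of the hypothesis over [D * D] is twice the conclusion.
Integrating in [v] and then in [v'] uses only single integrals.  The factor [s]
treats comonotone and countermonotone pairs at once. *)
Lemma chebyshev_integral (s : R) A B G :
  mu.-integrable D (EFin \o A) -> mu.-integrable D (EFin \o B) ->
  mu.-integrable D (EFin \o (fun v => A v * G v)) ->
  mu.-integrable D (EFin \o (fun v => B v * G v)) ->
  (forall v v', D v -> D v' ->
     0 <= s * ((A v * B v' - A v' * B v) * (G v - G v'))) ->
  0 <= s * (\int[mu]_(v in D) B v * \int[mu]_(v in D) (A v * G v) -
            \int[mu]_(v in D) A v * \int[mu]_(v in D) (B v * G v)).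
Proof.
move=> iA iB iAG iBG AB0.
set U := \int[mu]_(v in D) B v; set P := \int[mu]_(v in D) (A v * G v).
set Z := \int[mu]_(v in D) A v; set Q := \int[mu]_(v in D) (B v * G v).
have lin4 (c1 c2 c3 c4 : R) :
    mu.-integrable D (EFin \o (fun v => 1 * (c1 * (A v * G v) + c2 * A v) +
      1 * (c3 * (B v * G v) + c4 * B v))) /\
    \int[mu]_(v in D) (1 * (c1 * (A v * G v) + c2 * A v) +
      1 * (c3 * (B v * G v) + c4 * B v)) = c1 * P + c2 * Z + (c3 * Q + c4 * U).
  have [i1 e1] := Rintegral_lin2 c1 c2 iAG iA.
  have [i2 e2] := Rintegral_lin2 c3 c4 iBG iB.
  have [i3 e3] := Rintegral_lin2 1 1 i1 i2.
  by split=> //; rewrite e3 e1 e2 !mul1r.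
have inner v' : D v' ->
    0 <= s * (P * B v' - Z * (B v' * G v') - A v' * Q + A v' * G v' * U).
  move=> Dv'; have [_ e] := lin4 (s * B v') (- (s * (B v' * G v')))
    (- (s * A v')) (s * (A v' * G v')).
  have -> : s * (P * B v' - Z * (B v' * G v') - A v' * Q + A v' * G v' * U) =
    s * B v' * P + - (s * (B v' * G v')) * Z +
      (- (s * A v') * Q + s * (A v' * G v') * U) by ring.
  rewrite -e.
  apply: Rintegral_ge0 => v Dv; apply: le_trans (AB0 v v' Dv Dv') _.
  by rewrite le_eqVlt; apply/orP; left; apply/eqP; ring.
have [_] := lin4 (s * U) (- (s * Q)) (- (s * Z)) (s * P).
move=> e; suff : 0 <= 2 * (s * (U * P - Z * Q)) by rewrite pmulr_rge0.
have -> : 2 * (s * (U * P - Z * Q)) =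
  s * U * P + - (s * Q) * Z + (- (s * Z) * Q + s * P * U) by ring.
rewrite -e; apply: Rintegral_ge0 => v Dv; apply: le_trans (inner v Dv) _.
by rewrite le_eqVlt; apply/orP; left; apply/eqP; ring.
Qed.

End chebyshev.

(** * Two comonotone families *)

Section comparison.
Context {R : realType}.

Let two_cosh (x : R) := expR x + expR (- x).

Let two_cosh_norm x : two_cosh `|x| = two_cosh x.
Proof. by rewrite /two_cosh; case: (ger0P x) => // _; rewrite opprK addrC. Qed.

Let two_cosh_le x y : `|x| <= `|y| -> two_cosh x <= two_cosh y.
Proof.
rewrite -(two_cosh_norm x) -(two_cosh_norm y).
move: `|x| `|y| (normr_ge0 x) => {}x {}y x0 xy.
have exy : 0 <= (expR y - expR x) * (1 - expR (- x) * expR (- y)).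
  rewrite mulr_ge0 ?subr_ge0 ?ler_expR// -expRD -expR0 ler_expR; lra.
have ex := expRN x; have ey := expRN y.
have ex1 : expR x * expR (- x) = 1 by rewrite -expRD subrr expR0.
have ey1 : expR y * expR (- y) = 1 by rewrite -expRD subrr expR0.
rewrite /two_cosh -subr_ge0; apply: le_trans exy _.
rewrite le_eqVlt; apply/orP; left; apply/eqP.
have -> : (expR y - expR x) * (1 - expR (- x) * expR (- y)) =
  expR y - expR x - expR (- x) * (expR y * expR (- y)) +
   (expR x * expR (- x)) * expR (- y) by ring.
by rewrite ex1 ey1; ring.
Qed.

Let two_coshM x y : two_cosh x * two_cosh y = two_cosh (x + y) + two_cosh (x - y).
Proof. by rewrite /two_cosh !opprD !opprK !expRD; ring. Qed.

Let two_cosh_cross (x z t u : R) : 0 <= x <= z -> 0 <= t <= u ->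
  two_cosh (x / 2 * u) * two_cosh (z / 2 * t) <=
  two_cosh (x / 2 * t) * two_cosh (z / 2 * u).
Proof.
move=> /andP[x0 xz] /andP[t0 tu].
have h1 : 0 <= (z - x) * (u - t) by apply: mulr_ge0; rewrite subr_ge0.
have h2 : 0 <= (z - x) * (u + t) by apply: mulr_ge0; rewrite ?subr_ge0//; lra.
have h3 : 0 <= (z + x) * (u - t) by apply: mulr_ge0; rewrite ?subr_ge0//; lra.
have h4 : 0 <= x * u by apply: mulr_ge0 => //; exact: le_trans tu.
have h5 : 0 <= z * t by apply: mulr_ge0 => //; exact: le_trans xz.
rewrite !two_coshM; apply: lerD; apply: two_cosh_le.
  by rewrite !ger0_norm; lra.
rewrite [leRHS]distrC [leRHS]ger0_norm; last by lra.
by rewrite ler_norml; apply/andP; split; lra.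
Qed.

Definition sympow (a1 a2 v : R) := v `^ a1 + v `^ a2.

Let sympowE (a1 a2 v : R) : 0 < v ->
  sympow a1 a2 v = expR ((a1 + a2) / 2 * ln v) * two_cosh ((a1 - a2) / 2 * ln v).
Proof.
move=> v0; rewrite /sympow /powR !gt_eqF// /two_cosh mulrDr -!expRD.
by congr (expR _ + expR _); field.
Qed.

(** With [v = exp y], [sympow a1 a2 v] is
[2 exp ((a1 + a2) y / 2) cosh ((a1 - a2) y / 2)]; for [d <= e] the ratio
[cosh (d y) / cosh (e y)] decreases in [|y|], by the product formula for
[cosh]. *)
Lemma sympow_cross_le (a1 a2 b1 b2 v v' : R) :
  a1 + a2 = b1 + b2 -> `|a1 - a2| <= `|b1 - b2| ->
  0 < v -> 0 < v' -> `|ln v'| <= `|ln v| ->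
  sympow a1 a2 v * sympow b1 b2 v' <= sympow a1 a2 v' * sympow b1 b2 v.
Proof.
move=> ab dab v0 v'0 lv; rewrite !sympowE// ab.
move: (ln v) (ln v') lv => y y' lv.
set e1 := expR _; set e2 := expR _.
rewrite [leLHS](_ : _ = e1 * e2 * (two_cosh ((a1 - a2) / 2 * y) *
  two_cosh ((b1 - b2) / 2 * y'))); last by ring.
rewrite [leRHS](_ : _ = e1 * e2 * (two_cosh ((a1 - a2) / 2 * y') *
  two_cosh ((b1 - b2) / 2 * y))); last by ring.
apply: ler_wpM2l; first by rewrite mulr_ge0 ?expR_ge0.
rewrite -[two_cosh ((a1 - a2) / 2 * y)]two_cosh_norm.
rewrite -[two_cosh ((b1 - b2) / 2 * y')]two_cosh_norm.
rewrite -[two_cosh ((a1 - a2) / 2 * y')]two_cosh_norm.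
rewrite -[two_cosh ((b1 - b2) / 2 * y)]two_cosh_norm.
rewrite !normrM.
rewrite (_ : `|2^-1| = 2^-1 :> R); last by rewrite ger0_norm.
by apply: two_cosh_cross; apply/andP.
Qed.

Definition paired (g : R -> R) (r v : R) : R :=
  g (r * (1 + v) `^ (-1)) * g (r * (1 + v) `^ (-1) * v).

(** Both [s'] and [t'] are convex combinations of [s] and [t], with exchanged
weights. *)
Lemma convex_spread (k : R -> R) (s t s' t' : R) :
  convex_function (`]0, +oo[%classic : set R) k -> 0 < s -> 0 < t -> s + t = s' + t' ->
  Num.min s t <= s' <= Num.max s t -> k s' + k t' <= k s + k t.
Proof.
move=> ck s0 t0; wlog st : s t s0 t0 / s <= t.
  move=> H; have /orP[st|st] := le_total s t; first exact: H.
  by rewrite addrC minC maxC [k s + _]addrC; exact: H.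
rewrite min_l// max_r// => sum /andP[s1 s2].
have [est|nst] := eqVneq s t.
  have -> : s' = s by apply/eqP; rewrite eq_le s1 est s2.
  by have -> : t' = t by lra.
have {nst}st : s < t by rewrite lt_neqAle nst.
pose l := (t - s') / (t - s).
have l01 : 0 <= l <= 1.
  apply/andP; split; first by rewrite divr_ge0; lra.
  by rewrite ler_pdivrMr ?mul1r; lra.
have itvl : Itv.spec (@Itv.num_sem R) (Itv.Real `[0, 1]%Z) l.
  by rewrite /Itv.spec/= /Itv.num_sem/= in_itv/= l01 andbT num_real.
pose L : {i01 R} := Itv.mk itvl.
have Ds (x : R) : 0 < x -> x \in (`]0, +oo[%classic : set R).
  by move=> x0; rewrite inE pos_itvE.
have h1 : k (l * s + (1 - l) * t) <= l * k s + (1 - l) * k t.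
  exact: ck L s t (Ds s s0) (Ds t t0).
have h2 : k (l * t + (1 - l) * s) <= l * k t + (1 - l) * k s.
  exact: ck L t s (Ds t t0) (Ds s s0).
have ets : t - s != 0 by rewrite subr_eq0 gt_eqF.
have {}h1 : k s' <= l * k s + (1 - l) * k t.
  by rewrite (_ : s' = l * s + (1 - l) * t)// /l; field.
have {}h2 : k t' <= l * k t + (1 - l) * k s.
  rewrite (_ : t' = l * t + (1 - l) * s)//.
  have -> : t' = s + t - s' by lra.
  by rewrite /l; field.
suff : k s' + k t' <= (l * k s + (1 - l) * k t) + (l * k t + (1 - l) * k s).
  by move=> /le_trans; apply; rewrite le_eqVlt; apply/orP; left; apply/eqP; ring.
exact: lerD.
Qed.

(** [|ln v'| <= |ln v|] says that [v'] lies between [v] and [1 / v], and replacing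
[v] by [1 / v] exchanges the two parts into which [r] is split. *)
Lemma polar_split_between (r v v' : R) : 0 < r -> 0 < v -> 0 < v' ->
  `|ln v'| <= `|ln v| ->
  Num.min (r * (1 + v) `^ (-1)) (r * (1 + v) `^ (-1) * v) <=
    r * (1 + v') `^ (-1) <=
  Num.max (r * (1 + v) `^ (-1)) (r * (1 + v) `^ (-1) * v).
Proof.
move=> r0 v0 v'0 lv.
pose s w := r * (1 + w) `^ (-1).
rewrite -/(s v) -/(s v').
have sE w : 0 < w -> s w = r / (1 + w).
  by move=> w0; rewrite /s powR_inv1// addr_ge0// ltW.
have sV w : 0 < w -> s w * w = s w^-1.
  move=> w0; rewrite !sE ?invr_gt0//; field.
  by rewrite !gt_eqF//= addr_gt0.
have sle w w' : 0 < w -> w <= w' -> s w' <= s w.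
  move=> w0 ww; rewrite !sE//; last exact: lt_le_trans ww.
  by rewrite ler_pM2l// lef_pV2 ?posrE ?lerD2l// addr_gt0//; exact: lt_le_trans ww.
rewrite sV//; case/orP: (le_total 1 v) => v1.
  have v'v : v' <= v.
    rewrite -ler_ln ?posrE//; apply: le_trans (ler_norm _) _; apply: le_trans lv _.
    by rewrite ger0_norm// ln_ge0.
  have vv' : v^-1 <= v'.
    rewrite -ler_ln ?posrE ?invr_gt0// lnV ?posrE// lerNl.
    rewrite -[ln v]ger0_norm ?ln_ge0//; apply: le_trans lv.
    by rewrite -normrN ler_norm.
  apply/andP; split; first by rewrite ge_min sle.
  by rewrite le_max [s v' <= s v^-1]sle ?orbT// invr_gt0.
have lv0 : ln v <= 0 by exact: ln_le0.
have lvN : `|ln v'| <= - ln v by rewrite -(ler0_norm lv0).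
have v'v : v <= v'.
  rewrite -ler_ln ?posrE// -lerN2; apply: le_trans lvN.
  by rewrite -normrN ler_norm.
have vv' : v' <= v^-1.
  rewrite -ler_ln ?posrE ?invr_gt0// lnV ?posrE//.
  exact: le_trans (ler_norm _) lvN.
apply/andP; split; last by rewrite le_max sle.
by rewrite ge_min [s v^-1 <= s v']sle ?orbT.
Qed.

Lemma paired_log_concave_le (g : R -> R) (r v v' : R) :
  log_concave `]0, +oo[ g -> 0 < r -> 0 < v -> 0 < v' -> `|ln v'| <= `|ln v| ->
  paired g r v <= paired g r v'.
Proof.
move=> [g0 cg] r0 v0 v'0 lv.
have := polar_split_between r0 v0 v'0 lv.
have q0 w : 0 < w -> 0 < r * (1 + w) `^ (-1).
  by move=> w0; rewrite mulr_gt0// powR_gt0// addr_gt0.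
have {}g0 w : 0 < w -> 0 < g w by move=> w0; apply: g0; rewrite pos_itvE.
have gs w : 0 < w -> 0 < g (r * (1 + w) `^ (-1)) by move=> w0; apply/g0/q0.
have gt w : 0 < w -> 0 < g (r * (1 + w) `^ (-1) * w).
  by move=> w0; apply/g0/mulr_gt0 => //; exact: q0.
have sum := etrans (polar_splitE r v0) (esym (polar_splitE r v'0)).
move=> /(convex_spread cg (q0 v v0) (mulr_gt0 (q0 v v0) v0) sum).
rewrite -!opprD lerN2 -!lnM ?posrE ?gs ?gt//.
by rewrite ler_ln ?posrE ?mulr_gt0 ?gs ?gt.
Qed.

Lemma paired_log_convex_le (g : R -> R) (r v v' : R) :
  log_convex `]0, +oo[ g -> 0 < r -> 0 < v -> 0 < v' -> `|ln v'| <= `|ln v| ->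
  paired g r v' <= paired g r v.
Proof.
move=> [g0 cg] r0 v0 v'0 lv.
have := polar_split_between r0 v0 v'0 lv.
have q0 w : 0 < w -> 0 < r * (1 + w) `^ (-1).
  by move=> w0; rewrite mulr_gt0// powR_gt0// addr_gt0.
have {}g0 w : 0 < w -> 0 < g w by move=> w0; apply: g0; rewrite pos_itvE.
have gs w : 0 < w -> 0 < g (r * (1 + w) `^ (-1)) by move=> w0; apply/g0/q0.
have gt w : 0 < w -> 0 < g (r * (1 + w) `^ (-1) * w).
  by move=> w0; apply/g0/mulr_gt0 => //; exact: q0.
have sum := etrans (polar_splitE r v0) (esym (polar_splitE r v'0)).
move=> /(convex_spread cg (q0 v v0) (mulr_gt0 (q0 v v0) v0) sum).
rewrite -!lnM ?posrE ?gs ?gt//.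
by rewrite ler_ln ?posrE ?mulr_gt0 ?gs ?gt.
Qed.

Lemma sympow_paired_concave (g : R -> R) (a1 a2 b1 b2 r v v' : R) :
  log_concave `]0, +oo[ g -> a1 + a2 = b1 + b2 -> `|a1 - a2| <= `|b1 - b2| ->
  0 < r -> 0 < v -> 0 < v' ->
  0 <= (sympow a1 a2 v * sympow b1 b2 v' - sympow a1 a2 v' * sympow b1 b2 v) *
       (paired g r v - paired g r v').
Proof.
move=> cg ab dab r0 v0 v'0; case/orP: (le_total `|ln v'| `|ln v|) => lv.
  by apply: mulr_le0; rewrite subr_le0 ?sympow_cross_le// paired_log_concave_le.
by apply: mulr_ge0; rewrite subr_ge0 ?sympow_cross_le// paired_log_concave_le.
Qed.

Lemma sympow_paired_convex (g : R -> R) (a1 a2 b1 b2 r v v' : R) :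
  log_convex `]0, +oo[ g -> a1 + a2 = b1 + b2 -> `|a1 - a2| <= `|b1 - b2| ->
  0 < r -> 0 < v -> 0 < v' ->
  (sympow a1 a2 v * sympow b1 b2 v' - sympow a1 a2 v' * sympow b1 b2 v) *
       (paired g r v - paired g r v') <= 0.
Proof.
move=> cg ab dab r0 v0 v'0; case/orP: (le_total `|ln v'| `|ln v|) => lv.
  apply: mulr_le0_ge0; rewrite ?subr_le0 ?subr_ge0 ?sympow_cross_le//.
  exact: paired_log_convex_le.
apply: mulr_ge0_le0; rewrite ?subr_le0 ?subr_ge0 ?sympow_cross_le//.
exact: paired_log_convex_le.
Qed.

End comparison.

(** * Beta integrals and their weighted versions *)

Lemma powRD_gt0 (R : realType) (x a b : R) :
  0 < x -> x `^ (a + b) = x `^ a * x `^ b.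
Proof. by move=> x0; rewrite powRD// (gt_eqF x0) implybT. Qed.

(** The factor left, for [S = a1 + a2], of [s^a1 t^a2] and of the Jacobian
[r / (1 + v)^2] when the powers of [r] and [v] are taken out. *)
Definition beta_weight (R : realType) (S v : R) : R := (1 + v) `^ (- (S + 2)).

Definition power_mul (R : realType) (g : R -> R) (a t : R) : R := t `^ a * g t.

HB.lock Definition paired_moment (R : realType) (g : R -> R) (S a r : R) : R :=
  \int[lebesgue_measure]_(v in `]0, +oo[)
    (beta_weight S v * v `^ a * paired g r v).

Section beta_integrals.
Context {R : realType}.
Notation mu := (@lebesgue_measure R).

Let mD : measurable (`]0, +oo[%classic : set (measurableTypeR R)).
Proof. by []. Qed.

Lemma measurable_beta_weight (S : R) : measurable_fun setT (beta_weight S).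
Proof.
by apply: (measurableT_comp (@measurable_powR R _)); exact: measurable_funD.
Qed.

Lemma measurable_power_mul (g : R -> R) (a : R) :
  measurable_fun setT g -> measurable_fun setT (power_mul g a).
Proof. by move=> mg; apply: measurable_funM => //; exact: measurable_powR. Qed.

Lemma measurable_paired (g : R -> R) (r : R) :
  measurable_fun setT g -> measurable_fun setT (paired g r).
Proof.
move=> mg.
have mrq : measurable_fun setT (fun v : R => r * (1 + v) `^ (-1)).
  apply: measurable_funM => //.
  by apply: (measurableT_comp (@measurable_powR R (-1))); exact: measurable_funD.
apply: measurable_funM; first exact: measurableT_comp.
by apply: measurableT_comp => //; exact: measurable_funM.
Qed.

Lemma polar_kernel_power_mul (g : R -> R) (a1 a2 r v : R) : 0 < r -> 0 < v ->
  polar_kernel (power_mul g a1) (power_mul g a2) r v =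
  r `^ (a1 + a2 + 1) * (beta_weight (a1 + a2) v * v `^ a2 * paired g r v).
Proof.
move=> r0 v0; have w0 : 0 < 1 + v by rewrite addr_gt0.
rewrite /polar_kernel /power_mul /beta_weight /paired.
set p := r * (1 + v) `^ (-1); set gp := g p; set gq := g _.
have pE a : p `^ a = r `^ a * (1 + v) `^ (- a).
  by rewrite /p powRM ?powR_ge0 ?(ltW r0)// -powRrM mulN1r.
rewrite powRM ?(ltW v0)//; last by rewrite /p mulr_ge0 ?powR_ge0 ?(ltW r0).
rewrite !pE.
have -> : r `^ (a1 + a2 + 1) = r `^ a1 * r `^ a2 * r.
  by rewrite !powRD_gt0// powRr1// ltW.
have -> : (1 + v) `^ (- (a1 + a2 + 2)) =
    (1 + v) `^ (- a1) * (1 + v) `^ (- a2) * (1 + v) `^ (-1) ^+ 2.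
  have -> : - (a1 + a2 + 2) = - a1 + - a2 + (-1 + -1) by ring.
  by rewrite !powRD_gt0// expr2.
by ring.
Qed.

Lemma Gamma_gt0 (a : R) : -1 < a -> 0 < Gamma (a + 1).
Proof.
move=> a1; rewrite Gamma_laplace.
have [l0 /(_ 1 ltr01) li] := laplaceable_powR a1.
have le12 (t : R) : `[1, 2]%classic t -> expR (-2) / 2 <= t `^ a * expR (- (1 * t)).
  rewrite /= in_itv/= => /andP[t1 t2]; rewrite mulrC mul1r.
  apply: ler_pM; rewrite ?invr_ge0 ?expR_ge0//; last by rewrite ler_expR lerN2.
  apply: (@le_trans _ _ (t `^ (-1))).
    rewrite powR_inv1; last by lra.
    by rewrite lef_pV2 ?posrE//; lra.
  by rewrite ler_powR// ltW.
have c0 : 0 < expR (-2) / 2 :> R by rewrite divr_gt0 ?expR_gt0.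
apply: (lt_le_trans c0); rewrite laplaceE -lee_fin /Rintegral fineK; last first.
  exact: integrable_fin_num li.
apply: (@le_trans _ _ (\int[mu]_(t in `[1%R, 2%R]) (cst ((expR (-2) / 2)%:E) t))%E).
  rewrite integral_cst//= lebesgue_measure_itv/= lte_fin ltr1n -EFinB.
  by rewrite -EFinM lee_fin (_ : 2 - 1 = 1 :> R) ?mulr1//; ring.
have mf (A : set R) : measurable_fun A (fun t : R => (t `^ a * expR (- (1 * t)))%:E).
  apply/measurable_EFinP; apply: measurable_funTS; apply: measurable_funM.
    exact: measurable_powR.
  exact: measurable_expRN.
apply: (@le_trans _ _ (\int[mu]_(t in `[1%R, 2%R]) (t `^ a * expR (- (1 * t)))%:E)%E).
  apply: ge0_le_integral => //.
  - by move=> t _; rewrite lee_fin ltW.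
  - by apply: mf.
apply: ge0_subset_integral => //.
- by apply: mf.
- by move=> t _; rewrite lee_fin mulr_ge0 ?powR_ge0 ?expR_ge0.
- by move=> t /=; rewrite !in_itv/= => /andP[t1 _]; rewrite andbT (lt_le_trans _ t1).
Qed.

(** The convolution theorem for powers, at [x = 1]: the inner integral does not
depend on [r] up to a power of [r], so the product splits.  Its finiteness comes
from that of the left-hand side, as the Gamma factor is positive. *)
Lemma beta_integral (a1 a2 : R) : -1 < a1 -> -1 < a2 ->
  mu.-integrable `]0, +oo[ (EFin \o (fun v => beta_weight (a1 + a2) v * v `^ a2)) /\
  Gamma (a1 + 1) * Gamma (a2 + 1) =
    Gamma (a1 + a2 + 1 + 1) *
    \int[mu]_(v in `]0, +oo[) (beta_weight (a1 + a2) v * v `^ a2).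
Proof.
move=> h1 h2; rewrite !Gamma_laplace.
have h12 : -1 < a1 + a2 + 1 by lra.
pose k v := beta_weight (a1 + a2) v * v `^ a2.
have k0 v : 0 <= k v by rewrite mulr_ge0 ?powR_ge0.
have mk : measurable_fun setT k.
  by apply: measurable_funM; [exact: measurable_beta_weight|exact: measurable_powR].
have G0 : 0 < laplace (fun t : R => t `^ (a1 + a2 + 1)) 1.
  by rewrite -Gamma_laplace Gamma_gt0.
have e : ((laplace (fun t : R => t `^ a1) 1 * laplace (fun t : R => t `^ a2) 1)%:E =
    (laplace (fun t : R => t `^ (a1 + a2 + 1)) 1)%:E *
    \int[mu]_(v in `]0%R, +oo[) (k v)%:E)%E.
  rewrite laplace_polar_integral//; try exact: laplaceable_powR;
    try exact: measurable_powR; try by move=> t; exact: powR_ge0.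
  have [_ /(_ 1 ltr01) li] := laplaceable_powR h12.
  have -> : ((laplace (fun t : R => t `^ (a1 + a2 + 1)) 1)%:E =
     \int[mu]_(r in `]0%R, +oo[) (r `^ (a1 + a2 + 1) * expR (- (1 * r)))%:E)%E.
    by rewrite laplaceE /Rintegral fineK//; exact: integrable_fin_num li.
  have mh : measurable_fun (`]0, +oo[ : set R)
      (fun r : R => (r `^ (a1 + a2 + 1) * expR (- (1 * r)))%:E).
    apply/measurable_EFinP; apply: measurable_funTS; apply: measurable_funM.
      exact: measurable_powR.
    exact: measurable_expRN.
  have h0 (r : R) : `]0, +oo[%classic r ->
      (0 <= (r `^ (a1 + a2 + 1) * expR (- (1 * r)))%:E)%E.
    by move=> _; rewrite lee_fin mulr_ge0 ?powR_ge0 ?expR_ge0.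
  have K0 : (0 <= \int[mu]_(v in `]0%R, +oo[) (k v)%:E)%E.
    by apply: integral_ge0 => v _; rewrite lee_fin.
  rewrite -(ge0_integralZr mu mD mh h0 K0).
  apply: eq_integral => r; rewrite inE pos_itvE => r0.
  rewrite [in RHS]mulrC EFinM -muleA; congr (_ * _)%E.
  have mk' : measurable_fun (`]0, +oo[ : set R) (EFin \o k).
    by apply/measurable_EFinP; exact: measurable_funTS.
  have k0' (v : R) : `]0, +oo[%classic v -> (0 <= (EFin \o k) v)%E.
    by move=> _; rewrite lee_fin.
  rewrite -(ge0_integralZl_EFin mu mD k0' mk' (powR_ge0 r (a1 + a2 + 1))).
  apply: eq_integral => v; rewrite inE pos_itvE => v0; rewrite -EFinM; congr EFin.
  have pmE a : (fun t : R => t `^ a) = power_mul (cst 1) a.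
    by apply/funext => t; rewrite /power_mul mulr1.
  by rewrite !pmE polar_kernel_power_mul// /paired/= !mulr1.
have kfin : (\int[mu]_(v in `]0%R, +oo[) (k v)%:E < +oo)%E.
  rewrite ltNge leye_eq; apply/negP => /eqP ky; move: e.
  by rewrite ky gt0_muley ?lte_fin.
have ik : mu.-integrable `]0, +oo[ (EFin \o k).
  apply/integrableP; split; first by apply/measurable_EFinP; exact: measurable_funTS.
  by under eq_integral => v _ do rewrite /= ger0_norm//.
split=> //.
apply: EFin_inj; rewrite e EFinM; congr (_ * _)%E.
by rewrite /Rintegral fineK//; exact: integrable_fin_num ik.
Qed.

Lemma paired_momentE (g : R -> R) (S a r : R) : paired_moment g S a r =
  \int[mu]_(v in `]0, +oo[) (beta_weight S v * v `^ a * paired g r v).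
Proof. by rewrite paired_moment.unlock. Qed.

(** Both factors are at most [M exp (c t)] at arguments of sum [r], so the
integrand is bounded by a constant times [1 / (1 + v)^2]. *)
Lemma integrable_paired_moment (g : R -> R) (M c a1 a2 r : R) :
  measurable_fun setT g -> (forall t, 0 <= g t) ->
  (forall t, 0 < t -> power_mul g a1 t <= M * expR (c * t)) ->
  (forall t, 0 < t -> power_mul g a2 t <= M * expR (c * t)) ->
  0 < r ->
  mu.-integrable `]0, +oo[
    (EFin \o (fun v => beta_weight (a1 + a2) v * v `^ a2 * paired g r v)).
Proof.
move=> mg g0 b1 b2 r0.
have [i0 _] := @beta_integral 0 0 (ltrN10 R) (ltrN10 R).
pose K := r * (M ^+ 2 * expR (c * r)) / r `^ (a1 + a2 + 1).
apply: (le_integrable mD _ _ (integrableZl mD K i0)).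
  apply/measurable_EFinP; apply: measurable_funTS.
  apply: measurable_funM; last exact: measurable_paired.
  by apply: measurable_funM; [exact: measurable_beta_weight|exact: measurable_powR].
move=> v; rewrite pos_itvE => v0.
have w0 : 0 < 1 + v by rewrite addr_gt0.
have rS0 : 0 < r `^ (a1 + a2 + 1) by rewrite powR_gt0.
have s0 : 0 < r * (1 + v) `^ (-1) by rewrite mulr_gt0// powR_gt0.
have pm0 a t : 0 <= power_mul g a t by rewrite mulr_ge0 ?powR_ge0.
rewrite [X in (_ <= `|X|)%E](_ : _ =
  (K * (beta_weight (0 + 0) v * v `^ 0))%:E)// lee_fin.
rewrite ger0_norm; last by rewrite !mulr_ge0 ?powR_ge0.
apply: le_trans (ler_norm _); rewrite powRr0 mulr1 addr0.
rewrite -(ler_pM2l rS0) -polar_kernel_power_mul//.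
have -> : r `^ (a1 + a2 + 1) * (K * beta_weight 0 v) =
    r * (1 + v) `^ (-1) ^+ 2 * (M * expR (c * (r * (1 + v) `^ (-1))) *
      (M * expR (c * (r * (1 + v) `^ (-1) * v)))).
  have -> : beta_weight 0 v = (1 + v) `^ (-1) ^+ 2.
    by rewrite /beta_weight add0r expr2 -powRD_gt0//; congr powR; ring.
  have -> : expR (c * (r * (1 + v) `^ (-1) * v)) =
      expR (c * r) / expR (c * (r * (1 + v) `^ (-1))).
    by rewrite -expRN -expRD; congr expR; rewrite -{2}(polar_splitE r v0); ring.
  by rewrite /K; field; rewrite !gt_eqF ?expR_gt0.
rewrite /polar_kernel ler_wpM2l ?mulr_ge0 ?(ltW r0) ?exprn_ge0 ?powR_ge0//.
by apply: ler_pM => //; [exact: b1|apply: b2; rewrite mulr_gt0].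
Qed.

(** The convolution theorem for two functions with the same factor [g]: the power
of [r] comes out of the inner integral by homogeneity. *)
Lemma laplaceM_power_mul (g : R -> R) (M c a1 a2 : R) :
  measurable_fun setT g -> (forall t, 0 <= g t) ->
  (forall t, 0 < t -> power_mul g a1 t <= M * expR (c * t)) ->
  (forall t, 0 < t -> power_mul g a2 t <= M * expR (c * t)) ->
  laplaceable (power_mul g a1) -> laplaceable (power_mul g a2) ->
  laplaceable (fun r => r `^ (a1 + a2 + 1) * paired_moment g (a1 + a2) a2 r) /\
  forall x, 0 < x ->
    laplace (power_mul g a1) x * laplace (power_mul g a2) x =
    laplace (fun r => r `^ (a1 + a2 + 1) * paired_moment g (a1 + a2) a2 r) x.
Proof.
move=> mg g0 b1 b2 l1 l2.
have pm0 a t : 0 <= power_mul g a t by rewrite mulr_ge0 ?powR_ge0.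
have imom r (r0 : 0 < r) := integrable_paired_moment mg g0 b1 b2 r0.
have ker r : 0 < r -> mu.-integrable `]0, +oo[
    (EFin \o polar_kernel (power_mul g a1) (power_mul g a2) r).
  move=> r0.
  apply: eq_integrable (integrableZl mD (r `^ (a1 + a2 + 1)) (imom r r0)) => //.
  by move=> v; rewrite inE pos_itvE => v0 /=; rewrite polar_kernel_power_mul.
have convE r : 0 < r -> polar_conv (power_mul g a1) (power_mul g a2) r =
    r `^ (a1 + a2 + 1) * paired_moment g (a1 + a2) a2 r.
  move=> r0; rewrite paired_momentE -RintegralZl//; last exact: imom.
  by apply: eq_Rintegral => v; rewrite inE pos_itvE => v0; exact: polar_kernel_power_mul.
have [[c0 ci] cE] := laplace_polar_conv l1 l2 (measurable_power_mul a1 mg)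
  (measurable_power_mul a2 mg) (pm0 a1) (pm0 a2) ker.
split; first split=> [r r0|x x0].
- by rewrite -convE// c0.
- by apply: eq_integrable (ci x x0) => // r; rewrite inE pos_itvE => r0 /=; rewrite convE.
- by move=> x x0; rewrite cE//; exact: eq_laplace.
Qed.

End beta_integrals.

(** * Differences of two products *)

HB.lock Definition sym_moment (R : realType) (g : R -> R) (S a1 a2 r : R) : R :=
  \int[lebesgue_measure]_(v in `]0, +oo[)
    (beta_weight S v * sympow a1 a2 v * paired g r v).

HB.lock Definition sym_beta (R : realType) (a1 a2 : R) : R :=
  \int[lebesgue_measure]_(v in `]0, +oo[)
    (beta_weight (a1 + a2) v * sympow a1 a2 v).

Section two_point.
Context {R : realType}.
Notation mu := (@lebesgue_measure R).

Let mD : measurable (`]0, +oo[%classic : set (measurableTypeR R)).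
Proof. by []. Qed.

Lemma laplace_lin2 (c1 c2 : R) (phi1 phi2 : R -> R) :
  laplaceable phi1 -> laplaceable phi2 ->
  (forall t, 0 < t -> 0 <= c1 * phi1 t + c2 * phi2 t) ->
  laplaceable (fun t => c1 * phi1 t + c2 * phi2 t) /\
  forall x, 0 < x ->
    laplace (fun t => c1 * phi1 t + c2 * phi2 t) x =
    c1 * laplace phi1 x + c2 * laplace phi2 x.
Proof.
move=> [_ i1] [_ i2] h0.
have E x (t : R) : (c1 * phi1 t + c2 * phi2 t) * expR (- (x * t)) =
    c1 * (phi1 t * expR (- (x * t))) + c2 * (phi2 t * expR (- (x * t))) by ring.
have lin x (x0 : 0 < x) := Rintegral_lin2 mD c1 c2 (i1 x x0) (i2 x x0).
split; first split=> // x x0.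
  by apply: eq_integrable (lin x x0).1 => // t _; rewrite /= E.
by move=> x x0; rewrite !laplaceE -(lin x x0).2; apply: eq_Rintegral => t _; exact: E.
Qed.

Lemma sym_betaE (a1 a2 : R) : -1 < a1 -> -1 < a2 ->
  mu.-integrable `]0, +oo[
    (EFin \o (fun v => beta_weight (a1 + a2) v * sympow a1 a2 v)) /\
  sym_beta a1 a2 =
    \int[mu]_(v in `]0, +oo[) (beta_weight (a1 + a2) v * v `^ a1) +
    \int[mu]_(v in `]0, +oo[) (beta_weight (a1 + a2) v * v `^ a2).
Proof.
move=> h1 h2; have [i2 _] := beta_integral h1 h2.
have := beta_integral h2 h1; rewrite [a2 + a1]addrC => -[i1 _].
have [i e] := Rintegral_lin2 mD 1 1 i1 i2.
have E (v : R) : 1 * (beta_weight (a1 + a2) v * v `^ a1) +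
  1 * (beta_weight (a1 + a2) v * v `^ a2) = beta_weight (a1 + a2) v * sympow a1 a2 v.
  by rewrite /sympow; ring.
split; first by apply: eq_integrable i => // v _; rewrite /= E.
transitivity (1 * \int[mu]_(v in `]0, +oo[) (beta_weight (a1 + a2) v * v `^ a1) +
  1 * \int[mu]_(v in `]0, +oo[) (beta_weight (a1 + a2) v * v `^ a2)).
  by rewrite sym_beta.unlock -[RHS]e; apply: eq_Rintegral => v _; rewrite E.
by congr (_ + _); exact: mul1r.
Qed.

Lemma sym_momentE (g : R -> R) (S a1 a2 r : R) :
  mu.-integrable `]0, +oo[
    (EFin \o (fun v => beta_weight S v * v `^ a1 * paired g r v)) ->
  mu.-integrable `]0, +oo[
    (EFin \o (fun v => beta_weight S v * v `^ a2 * paired g r v)) ->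
  mu.-integrable `]0, +oo[
    (EFin \o (fun v => beta_weight S v * sympow a1 a2 v * paired g r v)) /\
  sym_moment g S a1 a2 r = paired_moment g S a1 r + paired_moment g S a2 r.
Proof.
move=> i1 i2; have [i e] := Rintegral_lin2 mD 1 1 i1 i2.
have E (v : R) : 1 * (beta_weight S v * v `^ a1 * paired g r v) +
  1 * (beta_weight S v * v `^ a2 * paired g r v) =
  beta_weight S v * sympow a1 a2 v * paired g r v.
  by rewrite /sympow; ring.
split; first by apply: eq_integrable i => // v _; rewrite /= E.
transitivity (1 * paired_moment g S a1 r + 1 * paired_moment g S a2 r).
  rewrite !paired_momentE sym_moment.unlock -[RHS]e.
  by apply: eq_Rintegral => v _; rewrite E.
by congr (_ + _); exact: mul1r.
Qed.

Lemma sym_beta_Gamma (a1 a2 : R) : -1 < a1 -> -1 < a2 ->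
  2 * (Gamma (a1 + 1) * Gamma (a2 + 1)) =
    Gamma (a1 + a2 + 1 + 1) * sym_beta a1 a2.
Proof.
move=> h1 h2; rewrite (sym_betaE h1 h2).2.
have [_] := beta_integral h1 h2; have [_] := beta_integral h2 h1.
rewrite [a2 + a1]addrC.
move: (Gamma (a1 + 1)) (Gamma (a2 + 1)) (Gamma _) => G1 G2 Z.
move: (\int[mu]_(_ in _) _) (\int[mu]_(_ in _) _) => B1 B2 e1 e2.
by rewrite mulrDr -e1 -e2; ring.
Qed.

Lemma laplaceM_sym_moment (g : R -> R) (M c a1 a2 : R) :
  measurable_fun setT g -> (forall t, 0 <= g t) ->
  (forall t, 0 < t -> power_mul g a1 t <= M * expR (c * t)) ->
  (forall t, 0 < t -> power_mul g a2 t <= M * expR (c * t)) ->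
  laplaceable (power_mul g a1) -> laplaceable (power_mul g a2) ->
  [/\ forall r, 0 < r -> mu.-integrable `]0, +oo[ (EFin \o
        (fun v => beta_weight (a1 + a2) v * sympow a1 a2 v * paired g r v)),
    laplaceable (fun r => r `^ (a1 + a2 + 1) * sym_moment g (a1 + a2) a1 a2 r) &
    forall x, 0 < x ->
    2 * (laplace (power_mul g a1) x * laplace (power_mul g a2) x) =
    laplace (fun r => r `^ (a1 + a2 + 1) * sym_moment g (a1 + a2) a1 a2 r) x].
Proof.
move=> mg g0 b1 b2 l1 l2.
have [k2 e2] := laplaceM_power_mul mg g0 b1 b2 l1 l2.
have := laplaceM_power_mul mg g0 b2 b1 l2 l1; rewrite [a2 + a1]addrC => -[k1 e1].
have i2 r (r0 : 0 < r) := integrable_paired_moment mg g0 b1 b2 r0.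
have := integrable_paired_moment mg g0 b2 b1; rewrite [a2 + a1]addrC => i1.
have lin r (r0 : 0 < r) := sym_momentE (i1 r r0) (i2 r r0).
have [k10 _] := k1; have [k20 _] := k2.
have [|l e] := laplace_lin2 (c1 := 1) (c2 := 1) k1 k2.
  by move=> t t0; rewrite !mul1r addr_ge0 ?k10 ?k20.
have E2 r : 0 < r -> 1 * (r `^ (a1 + a2 + 1) * paired_moment g (a1 + a2) a1 r) +
    1 * (r `^ (a1 + a2 + 1) * paired_moment g (a1 + a2) a2 r) =
    r `^ (a1 + a2 + 1) * sym_moment g (a1 + a2) a1 a2 r.
  by move=> r0; rewrite (lin r r0).2; ring.
split.
- by move=> r r0; exact: (lin r r0).1.
- split=> [t t0|x x0]; first by rewrite -E2//; exact: l.1.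
  by apply: eq_integrable (l.2 x x0) => // t; rewrite inE pos_itvE => t0; rewrite /= E2.
- move=> x x0; transitivity (1 * laplace (fun r => r `^ (a1 + a2 + 1) *
      paired_moment g (a1 + a2) a1 r) x + 1 * laplace (fun r => r `^ (a1 + a2 + 1) *
      paired_moment g (a1 + a2) a2 r) x); last first.
    by rewrite -e//; exact: eq_laplace.
  by rewrite -e1// -e2//; ring.
Qed.

(** The division by the Gamma function, which is the transform at [x = 1] for
[g = 1], removes the coefficient in front of the second product. *)
Definition normalized_laplace (g : R -> R) (a x : R) : R :=
  laplace (power_mul g a) x / Gamma (a + 1).

Lemma sym_beta_gt0 (a1 a2 : R) : -1 < a1 -> -1 < a2 -> 0 < sym_beta a1 a2.
Proof.
move=> h1 h2; have h : -1 < a1 + a2 + 1 by lra.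
have e := sym_beta_Gamma h1 h2.
rewrite -(pmulr_rgt0 _ (Gamma_gt0 h)) -e.
by apply: mulr_gt0 => //; apply: mulr_gt0; exact: Gamma_gt0.
Qed.

Let normalization (F1 F2 F3 F4 G1 G2 G3 G4 Z T U s : R) :
  0 < G1 -> 0 < G2 -> 0 < G3 -> 0 < G4 -> 0 < Z ->
  2 * (G1 * G2) = Z * T -> 2 * (G3 * G4) = Z * U ->
  (Z * T * U)^-1 * (s * U * (2 * (F1 * F2)) + - (s * T) * (2 * (F3 * F4))) =
  s * (F1 / G1 * (F2 / G2) - F3 / G3 * (F4 / G4)).
Proof.
move=> g1 g2 g3 g4 z eT eU.
have -> : T = 2 * (G1 * G2) / Z by rewrite eT mulrAC mulfV ?mul1r ?gt_eqF.
have -> : U = 2 * (G3 * G4) / Z by rewrite eU mulrAC mulfV ?mul1r ?gt_eqF.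
by field; rewrite !gt_eqF.
Qed.

(** Up to a positive constant this is, with [S = a1 + a2], the Laplace transform
of [r^(S + 1)] times the quantity that [chebyshev_integral] shows to be
nonnegative. *)
Lemma cm_two_point (g : R -> R) (M c s a1 a2 b1 b2 : R) :
  measurable_fun setT g -> (forall t, 0 <= g t) ->
  (forall a, a \in [:: a1; a2; b1; b2] -> [/\ -1 < a,
     laplaceable (power_mul g a) &
     forall t, 0 < t -> power_mul g a t <= M * expR (c * t)]) ->
  a1 + a2 = b1 + b2 ->
  (forall r v v', 0 < r -> 0 < v -> 0 < v' ->
    0 <= s * ((sympow a1 a2 v * sympow b1 b2 v' - sympow a1 a2 v' * sympow b1 b2 v) *
       (paired g r v - paired g r v'))) ->
  completely_monotonic `]0, +oo[ (fun x => s *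
    (normalized_laplace g a1 x * normalized_laplace g a2 x -
     normalized_laplace g b1 x * normalized_laplace g b2 x)).
Proof.
move=> mg g0 H ab comon.
have [|a1n l1 B1] := H a1; first by rewrite !inE eqxx.
have [|a2n l2 B2] := H a2; first by rewrite !inE eqxx ?orbT.
have [|b1n l3 B3] := H b1; first by rewrite !inE eqxx ?orbT.
have [|b2n l4 B4] := H b2; first by rewrite !inE eqxx ?orbT.
have Z0 : 0 < Gamma (a1 + a2 + 1 + 1) by apply: Gamma_gt0; lra.
have [iA lA eA] := laplaceM_sym_moment mg g0 B1 B2 l1 l2.
have [iB lB eB] := laplaceM_sym_moment mg g0 B3 B4 l3 l4.
have [iT _] := sym_betaE a1n a2n; have eT := sym_beta_Gamma a1n a2n.
have [iU _] := sym_betaE b1n b2n; have eU := sym_beta_Gamma b1n b2n.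
have T0 := sym_beta_gt0 a1n a2n; have U0 := sym_beta_gt0 b1n b2n.
rewrite -ab in iB lB eB iU eU.
set S := a1 + a2 in iA lA eA iB lB eB iT iU eT eU Z0.
have [|l e] := laplace_lin2 (c1 := s * sym_beta b1 b2)
    (c2 := - (s * sym_beta a1 a2)) lA lB.
  move=> r r0.
  have -> : s * sym_beta b1 b2 * (r `^ (S + 1) * sym_moment g S a1 a2 r) +
    - (s * sym_beta a1 a2) * (r `^ (S + 1) * sym_moment g S b1 b2 r) =
    r `^ (S + 1) *
     (s * (sym_beta b1 b2 * sym_moment g S a1 a2 r -
        sym_beta a1 a2 * sym_moment g S b1 b2 r)) by ring.
  apply: mulr_ge0; first exact: powR_ge0.
  rewrite sym_beta.unlock sym_moment.unlock -ab -/S.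
  apply: (chebyshev_integral mD (G := paired g r)) => //; first exact: iA.
    exact: iB.
  move=> v v'; rewrite !pos_itvE => v0 v'0.
  have -> : s * ((beta_weight S v * sympow a1 a2 v * (beta_weight S v' * sympow b1 b2 v') -
       beta_weight S v' * sympow a1 a2 v' * (beta_weight S v * sympow b1 b2 v)) *
      (paired g r v - paired g r v')) =
    beta_weight S v * beta_weight S v' *
    (s * ((sympow a1 a2 v * sympow b1 b2 v' - sympow a1 a2 v' * sympow b1 b2 v) *
       (paired g r v - paired g r v'))) by ring.
  by rewrite mulr_ge0 ?comon// mulr_ge0 ?powR_ge0.
have c0 : 0 <= (Gamma (S + 1 + 1) * sym_beta a1 a2 * sym_beta b1 b2)^-1.
  by rewrite invr_ge0; exact: ltW (mulr_gt0 (mulr_gt0 Z0 T0) U0).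
apply: cm_ext (cm_mul (cm_cst c0) (cm_laplace l)) => x x0.
rewrite (e x x0) -(eA x x0) -(eB x x0).
exact: (normalization _ _ _ _ s (Gamma_gt0 a1n) (Gamma_gt0 a2n) (Gamma_gt0 b1n)
  (Gamma_gt0 b2n) Z0 eT eU).
Qed.

End two_point.

(** * From two factors to n *)

Section majorization_chain.
Context {R : realType}.
Implicit Types (p q : seq R).
Local Notation sum l := (\sum_(a <- l) a).

Lemma sum_le_size (c : R) (l : seq R) : all (<= c) l -> sum l <= c *+ size l.
Proof.
elim: l => [|a l IH] /=; first by rewrite big_nil.
by move=> /andP[ac /IH lc]; rewrite big_cons mulrS lerD.
Qed.

Lemma sum_ge_size (c : R) (l : seq R) :
  all (> c) l -> c *+ size l <= sum l ?= iff (l == [::]).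
Proof.
elim: l => [|a l IH] /=; first by rewrite big_nil; split; rewrite ?eqxx.
move=> /andP[ac /IH lc]; rewrite big_cons mulrS; apply/leifP.
by rewrite ltr_leD// lc.
Qed.

Variables (P : R -> Prop) (Psi : R -> R -> R) (s : R).
Hypothesis P_between : forall a b c, P a -> P b -> a <= c <= b -> P c.
Hypothesis cm_Psi : forall a, P a -> completely_monotonic `]0, +oo[ (Psi a).
Hypothesis cm_transfer : forall a1 a2 b1 b2, P a1 -> P a2 -> P b1 -> P b2 ->
  a1 + a2 = b1 + b2 -> `|a1 - a2| <= `|b1 - b2| ->
  completely_monotonic `]0, +oo[
    (fun x => s * (Psi a1 x * Psi a2 x - Psi b1 x * Psi b2 x)).

Let cm_prod_seq l : (forall a, a \in l -> P a) ->
  completely_monotonic `]0, +oo[ (fun x => \prod_(a <- l) Psi a x).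
Proof.
elim: l => [|a l IH] Pl; first by apply: cm_ext (cm_cst ler01) => x _; rewrite big_nil.
have Pa : P a by apply: Pl; rewrite mem_head.
have {}IH := IH (fun b bl => Pl b (mem_behead (s := a :: l) bl)).
by apply: cm_ext (cm_mul (cm_Psi Pa) IH) => x _; rewrite big_cons.
Qed.

(** Induction on the length.  As [p1] is the largest entry of [p], it lies between
two consecutive entries [a] and [b] of [q].  Replacing them by [p1] and
[a + b - p1] is a transfer; then [p1] is removed from both lists, and what remains
of [q], with [a + b - p1] in the place of [a] and [b], is still sorted and still
majorizes the rest of [p]. *)
Lemma cm_majorization p q : size p = size q ->
  sorted >=%R p -> sorted >=%R q ->
  (forall a, a \in p -> P a) -> (forall a, a \in q -> P a) ->
  (forall m, sum (take m p) <= sum (take m q)) -> sum p = sum q ->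
  completely_monotonic `]0, +oo[
    (fun x => s * (\prod_(a <- p) Psi a x - \prod_(a <- q) Psi a x)).
Proof.
have ge_tr : transitive (>=%R : rel R) by move=> y x z xy yz; exact: le_trans yz xy.
elim: p q => [|p1 p IH] q.
  move=> /esym/size0nil -> _ _ _ _ _ _.
  by apply: cm_ext (cm_cst (lexx 0)) => x _; rewrite subrr mulr0.
move=> spq sp sq Pp Pq maj sumE.
have p1max : all (<= p1) p by exact: order_path_min sp.
have Pp1 : P p1 by apply: Pp; rewrite mem_head.
have Pp' a : a \in p -> P a by move=> ap; apply: Pp; rewrite in_cons ap orbT.
have sp' : sorted >=%R p by exact: path_sorted sp.
have hasq : has (<= p1) q.
  rewrite -[has _ _]negbK -all_predC; apply/negP => allq.
  have allq' : all (> p1) q by apply: sub_all allq => a /=; rewrite -ltNge.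
  have := sum_ge_size allq'; move/lt_leif; rewrite -size_eq0 -spq /= => /esym.
  by rewrite ltNge -sumE sum_le_size//= lexx.
move: (hasq); rewrite has_find => ltq.
set i := find _ _ in ltq.
have qE : q = take i q ++ nth 0 q i :: drop i.+1 q by rewrite -drop_nth// cat_take_drop.
have bp1 : nth 0 q i <= p1 by exact: (nth_find 0 hasq).
have Agt : all (> p1) (take i q).
  apply/(all_nthP 0) => j; rewrite (size_takel (ltnW ltq)) => ji.
  by rewrite nth_take// ltNge; have := before_find 0 ji; move/negbT.
move: (take i q) (nth 0 q i) (drop i.+1 q) qE bp1 Agt => A' b B.
case/lastP: A' => [|A a].
  rewrite /= => qE bp1 _; have p1b : p1 = b.
    apply/eqP; rewrite eq_le bp1 andbT.
    by have := maj 1%N; rewrite qE /= !take0 !big_seq1.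
  subst q b; have cmIH : completely_monotonic `]0, +oo[
    (fun x => s * (\prod_(a <- p) Psi a x - \prod_(a <- B) Psi a x)).
    apply: IH => //.
    - by case: spq.
    - exact: path_sorted sq.
    - by move=> a aB; apply: Pq; rewrite in_cons aB orbT.
    - by move=> m; have := maj m.+1; rewrite /= !big_cons lerD2l.
    - by move: sumE; rewrite !big_cons => /addrI.
  apply: cm_ext (cm_mul (cm_Psi Pp1) cmIH) => x _.
  by rewrite !big_cons; ring.
rewrite cat_rcons all_rcons => qE bp1 /andP[ap1 Agt].
subst q; set c := a + b - p1.
have Pa : P a by apply: Pq; rewrite mem_cat !in_cons eqxx !orbT.
have Pb : P b by apply: Pq; rewrite mem_cat !in_cons eqxx !orbT.
have PA y : y \in A -> P y by move=> yA; apply: Pq; rewrite mem_cat yA.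
have PB y : y \in B -> P y by move=> yB; apply: Pq; rewrite mem_cat !in_cons yB !orbT.
have bca : b <= c <= a by rewrite /c; apply/andP; split; lra.
have Pc : P c by exact: P_between bca.
have sq' : sorted >=%R (A ++ c :: B).
  move: sq; rewrite !(sorted_pairwise ge_tr) !pairwise_cat !allrel_consr /=.
  move=> /andP[/andP[Aa /andP[Ab AB]] /and3P[-> /andP[ab aB] /andP[bB ->]]].
  rewrite AB !andbT /=; apply/andP; split.
    by apply: sub_all Aa => y /= /(le_trans _); apply; case/andP: bca.
  by apply: sub_all bB => y /= /le_trans; apply; case/andP: bca.
have spq' : size p = size (A ++ c :: B).
  by move: spq; rewrite /= !size_cat /= !addnS => -[].
have cmIH : completely_monotonic `]0, +oo[
  (fun x => s * (\prod_(a <- p) Psi a x - \prod_(a <- A ++ c :: B) Psi a x)).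
  apply: IH => //.
  - by move=> y; rewrite mem_cat in_cons => /or3P[/PA|/eqP ->|/PB].
  (* Before c the entries of the new list exceed p1, hence those of p; from c
     on, the sums differ by p1 from those of the original lists. *)
  - move=> m; have [mA|Am] := leqP m (size A).
      rewrite take_cat; have -> : (if (m < size A)%N then take m A else
          A ++ take (m - size A) (c :: B)) = take m A.
        case: ltngtP mA => // -> _.
        by rewrite subnn take0 cats0 take_size.
      have sz : size (take m p) = size (take m A).
        rewrite !size_takel//.
        by rewrite spq' size_cat (leq_trans mA)// leq_addr.
      have hA : all (> p1) (take m A).
        by apply/allP => y /mem_take yA; exact: (allP Agt).
      have hp : all (<= p1) (take m p).
        by apply/allP => y /mem_take yp; exact: (allP p1max).
      apply: le_trans (sum_le_size hp) _; rewrite sz.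
      by have [] := sum_ge_size hA.
    have := maj m.+1; rewrite !take_cat /=.
    rewrite ![(_ < size A)%N]ltnNge (ltnW Am) (leqW (ltnW Am)) /=.
    rewrite (subSn (ltnW Am)).
    have -> : (m - size A = (m - size A).-1.+1)%N by rewrite prednK// subn_gt0.
    rewrite /= !big_cat /= !big_cons /c => h.
    rewrite -(lerD2l p1); apply: le_trans h _.
    by rewrite le_eqVlt; apply/orP; left; apply/eqP; ring.
  - apply: (@addrI _ p1); move: sumE; rewrite !big_cat !big_cons /= => ->.
    by rewrite /c; ring.
have cmT : completely_monotonic `]0, +oo[
    (fun x => s * (Psi p1 x * Psi c x - Psi a x * Psi b x)).
  apply: cm_transfer => //; first by rewrite /c; ring.
  rewrite [leRHS]ger0_norm; last by lra.
  by rewrite ler_norml /c; apply/andP; split; lra.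
apply: cm_ext (cm_add (cm_mul (cm_Psi Pp1) cmIH)
  (cm_mul cmT (cm_mul (cm_prod_seq PA) (cm_prod_seq PB)))) => x _.
by rewrite !big_cat /= !big_cons; ring.
Qed.

End majorization_chain.

(** * The theorem *)

Section assembly.
Context {R : realType}.
Notation mu := (@lebesgue_measure R).

Lemma majorized_seq (n : nat) (p q : n.-tuple R) : majorized p q ->
  (forall m, \sum_(a <- take m p) a <= \sum_(a <- take m q) a) /\
  \sum_(a <- p) a = \sum_(a <- q) a.
Proof.
move=> [_ _ _ maj sumE].
have sumtE (r : n.-tuple R) m : (m <= n)%N ->
    \sum_(a <- take m r) a = \sum_(0 <= j < m) r`_j.
  move=> mn; rewrite (big_nth 0) size_takel ?size_tuple//.
  by rewrite !big_mkord; apply: eq_bigr => j _; rewrite nth_take.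
have sumallE (r : n.-tuple R) : \sum_(a <- r) a = \sum_(0 <= j < n) r`_j.
  by rewrite -sumtE// take_oversize// size_tuple.
split; last by rewrite !sumallE.
move=> m; have [nm|mn] := leqP n m.
  by rewrite !take_oversize ?size_tuple// !sumallE sumE.
case: m mn => [|m] mn; first by rewrite !take0.
rewrite !sumtE ?(ltnW mn)//; apply: maj.
by rewrite /= -ltnS (ltn_predK mn).
Qed.

Lemma sorted_last_le (n : nat) (p : n.-tuple R) : sorted >=%R p ->
  forall a, a \in (p : seq R) -> p`_n.-1 <= a.
Proof.
move=> sp a /(nthP 0)[j]; rewrite size_tuple => jn <-.
have ge_tr : transitive (>=%R : rel R) by move=> y x z xy yz; exact: le_trans yz xy.
have ge_refl : reflexive (>=%R : rel R) by move=> x; exact: lexx.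
have n1 : (n.-1 < n)%N by rewrite (ltn_predK jn).
have j1 : (j <= n.-1)%N by rewrite -ltnS (ltn_predK jn).
by apply: (sorted_leq_nth ge_tr ge_refl 0 sp j n.-1 _ _ j1); rewrite inE size_tuple.
Qed.

Variables (f : R -> R) (I : set R).
Hypothesis itvI : is_interval I.
Hypothesis cvgF : forall p : R, I p -> forall x : R, 0 < x ->
  mu.-integrable `]0, +oo[ (EFin \o laplace_integrand f p x).
Variables (M c : R).
Hypothesis boundf : forall t p : R, 0 < t -> I p ->
  0 < t `^ p * f t <= M * expR (c * t).
Variable theta : R.

(** Restricted to the half-line, so as to be measurable on the whole line. *)
Let g : R -> R := (fun t => t `^ theta * f t) \_ `]0, +oo[.

Let gE (t : R) : 0 < t -> g t = t `^ theta * f t.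
Proof. by move=> t0; rewrite /g patchE mem_set// pos_itvE. Qed.

Let power_mul_g (p t : R) : 0 < t -> power_mul g (p - theta) t = t `^ p * f t.
Proof.
by move=> t0; rewrite /power_mul gE// mulrA -powRD_gt0// subrK.
Qed.

Let laplaceable_g (p : R) : I p -> laplaceable (power_mul g (p - theta)).
Proof.
move=> Ip; split=> [t t0|x x0].
  by rewrite power_mul_g// ltW//; have /andP[] := boundf t0 Ip.
apply: eq_integrable (cvgF Ip x0) => // t; rewrite inE pos_itvE => t0.
by rewrite /= power_mul_g.
Qed.

Let laplaceFE (p x : R) : laplaceF f p x = laplace (power_mul g (p - theta)) x.
Proof.
rewrite laplaceE; apply: eq_Rintegral => t.
by rewrite inE pos_itvE => t0; rewrite power_mul_g.
Qed.

Let g_ge0 (p : R) : I p -> forall t, 0 <= g t.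
Proof.
move=> Ip t; rewrite /g patchE; case: ifPn => //; rewrite inE pos_itvE => t0.
rewrite mulr_ge0 ?powR_ge0//; have /andP[] := boundf t0 Ip.
by rewrite pmulr_rgt0 ?powR_gt0// => /ltW.
Qed.

Let measurable_g (p : R) : I p -> measurable_fun setT g.
Proof.
move=> Ip.
suff mf : measurable_fun (`]0, +oo[ : set R) (fun t => t `^ theta * f t).
  have mD : measurable (`]0, +oo[ : set (measurableTypeR R)) by [].
  by have [+ _] := measurable_restrictT (fun t => t `^ theta * f t) mD; apply.
apply: (@eq_measurable_fun _ _ _ _ _
    (fun t => t `^ (theta - p) * power_mul g (p - theta) t)).
  move=> t; rewrite inE pos_itvE => t0.
  by rewrite power_mul_g// mulrA -powRD_gt0// subrK.
apply: measurable_funM; last exact: laplaceable_measurable (laplaceable_g Ip).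
by apply: measurable_funTS; exact: measurable_powR.
Qed.

Let paired_gE (r v : R) : 0 < r -> 0 < v ->
  paired g r v = paired (fun t => t `^ theta * f t) r v.
Proof.
move=> r0 v0; have q0 : 0 < r * (1 + v) `^ (-1) by rewrite mulr_gt0 ?powR_gt0 ?addr_gt0.
by rewrite /paired !gE// mulr_gt0.
Qed.

(** The sign [s] is [1] for log-concave and [-1] for log-convex [t^theta f(t)].
Multiplying the normalised difference by the Gamma factors of [p] gives back
[laplace_diff]. *)
Lemma cm_laplace_diff (n : nat) (p q : n.-tuple R) (s : R) :
  (0 < n)%N ->
  (forall j, I (tnth p j)) -> (forall j, I (tnth q j)) -> majorized p q ->
  theta < 1 + Num.min p`_n.-1 q`_n.-1 ->
  (forall a1 a2 b1 b2 r v v' : R, a1 + a2 = b1 + b2 -> `|a1 - a2| <= `|b1 - b2| ->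
    0 < r -> 0 < v -> 0 < v' ->
    0 <= s * ((sympow a1 a2 v * sympow b1 b2 v' - sympow a1 a2 v' * sympow b1 b2 v) *
       (paired (fun t => t `^ theta * f t) r v -
        paired (fun t => t `^ theta * f t) r v'))) ->
  completely_monotonic `]0, +oo[ (fun x => s * laplace_diff f p q theta x).
Proof.
move=> n0 pI qI pq thetapq comon.
have I0 := pI (Ordinal n0).
pose P a := I a /\ theta - 1 < a.
pose Psi a x := normalized_laplace g (a - theta) x.
have Plast (r : n.-tuple R) : (forall j, I (tnth r j)) -> sorted >=%R r ->
    theta < 1 + r`_n.-1 -> forall a, a \in (r : seq R) -> P a.
  move=> rI sr tr a ar; split; first by have /tnthP[j ->] := ar.
  by have := sorted_last_le sr ar; lra.
have [_ sq sp _ _] := pq; have [maj sumE] := majorized_seq pq.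
have [thetap thetaq] : theta < 1 + p`_n.-1 /\ theta < 1 + q`_n.-1.
  by move: thetapq; rewrite -ltrBlDl lt_min => /andP[h1 h2]; split; rewrite -ltrBlDl.
have Pp := Plast p pI sp thetap; have Pq := Plast q qI sq thetaq.
have cmPsi a : P a -> completely_monotonic `]0, +oo[ (Psi a).
  move=> [Ia ha]; have G0 : 0 <= (Gamma (a - theta + 1))^-1.
    by rewrite invr_ge0 ltW// Gamma_gt0; lra.
  apply: cm_ext (cm_mul (cm_laplace (laplaceable_g Ia)) (cm_cst G0)) => x _.
  by [].
have main : completely_monotonic `]0, +oo[
    (fun x => s * (\prod_(a <- p) Psi a x - \prod_(a <- q) Psi a x)).
  apply: (@cm_majorization _ P Psi) => //; last by rewrite !size_tuple.
  - move=> a b d [Ia ha] [Ib hb] abd; split; first exact: itvI Ia Ib _ abd.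
    by case/andP: abd => ad _; exact: lt_le_trans ad.
  - move=> a1 a2 b1 b2 Pa1 Pa2 Pb1 Pb2 ab dab.
    apply: (@cm_two_point _ g M c).
    + exact: measurable_g I0.
    + exact: g_ge0 I0.
    + have HP a : P a -> [/\ -1 < a - theta, laplaceable (power_mul g (a - theta)) &
          forall t, 0 < t -> power_mul g (a - theta) t <= M * expR (c * t)].
        move=> [Ia ha]; split; [by lra|exact: laplaceable_g|].
        by move=> t t0; rewrite power_mul_g//; have /andP[] := boundf t0 Ia.
      by move=> a; rewrite !inE => /or4P[] /eqP ->; exact: HP.
    + by move: ab; lra.
    + move=> r v v' r0 v0 v'0; rewrite !paired_gE//; apply: comon => //; first by lra.
      by rewrite !opprB !addrA !subrK.
have G0 (r : n.-tuple R) : (forall a, a \in (r : seq R) -> P a) ->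
    0 < \prod_(j < n) Gamma (tnth r j - theta + 1).
  move=> Pr; apply: prodr_gt0 => j _; apply: Gamma_gt0.
  by have [_] := Pr _ (mem_tnth j r); lra.
have PsiE (r : n.-tuple R) x : (forall a, a \in (r : seq R) -> P a) ->
    \prod_(a <- r) Psi a x =
    \prod_(j < n) laplaceF f (tnth r j) x / \prod_(j < n) Gamma (tnth r j - theta + 1).
  move=> Pr; rewrite big_tuple -prodf_div; apply: eq_bigr => j _.
  by rewrite /Psi /normalized_laplace laplaceFE.
have normalize (Fp Fq Gp Gq : R) : 0 < Gp -> 0 < Gq ->
    Gp * (s * (Fp / Gp - Fq / Gq)) = s * (Fp - Gp / Gq * Fq).
  by move=> Gp0 Gq0; field; rewrite !gt_eqF.
apply: cm_ext (cm_mul (cm_cst (ltW (G0 p Pp))) main) => x _.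
rewrite (PsiE p x Pp) (PsiE q x Pq) /laplace_diff /lambda_ratio prodf_div.
exact: normalize (G0 p Pp) (G0 q Pq).
Qed.

End assembly.

Theorem theorem2 (R : realType) (f : R -> R) (n : nat) (n_ge2 : (2 <= n)%N)
  (I : set R) (itvI : is_interval I)
  (cvgF : forall p : R, I p -> forall x : R, 0 < x ->
     lebesgue_measure.-integrable `]0, +oo[ (EFin \o laplace_integrand f p x))
  (M c : R) (M_gt0 : 0 < M) (c_ge0 : 0 <= c)
  (boundf : forall t p : R, 0 < t -> I p ->
     0 < t `^ p * f t <= M * expR (c * t))
  (p q : n.-tuple R)
  (pI : forall j : 'I_n, I (tnth p j)) (qI : forall j : 'I_n, I (tnth q j))
  (pq : majorized p q) :
  (forall theta : R, theta < 1 + Num.min p`_n.-1 q`_n.-1 ->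
     log_concave `]0, +oo[ (fun t => t `^ theta * f t) ->
     completely_monotonic `]0, +oo[ (laplace_diff f p q theta))
  /\
  (forall theta : R, theta < 1 + Num.min p`_n.-1 q`_n.-1 ->
     log_convex `]0, +oo[ (fun t => t `^ theta * f t) ->
     completely_monotonic `]0, +oo[ (fun x => - laplace_diff f p q theta x)).
Proof.
have n0 : (0 < n)%N by exact: leq_trans n_ge2.
split=> theta thetapq gcv.
  apply: cm_ext (@cm_laplace_diff R f I itvI cvgF M c boundf theta n p q 1
    n0 pI qI pq thetapq _) => [x _|]; first by rewrite mul1r.
  move=> a1 a2 b1 b2 r v v' ab dab r0 v0 v'0; rewrite mul1r.
  exact: sympow_paired_concave.
apply: cm_ext (@cm_laplace_diff R f I itvI cvgF M c boundf theta n p q (-1)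
  n0 pI qI pq thetapq _) => [x _|]; first by rewrite mulN1r.
move=> a1 a2 b1 b2 r v v' ab dab r0 v0 v'0; rewrite mulN1r oppr_ge0.
exact: sympow_paired_convex.
Qed.
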